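(* Let $d\ge 1$ be an integer and let $\alpha<2$ be such that $\alpha\in(2-d,4-d)$. Let $\nabla K(x)=x|x|^{\alpha-2}$ on $\mathbb{R}^d$. Then for any integer $n\ge 2$ there exists an $n$ delta-ring solution to the aggregation equation $u_t+\operatorname{div}(uv)=0$, $v=-\nabla K*u$; that is, there exists a radially symmetric first-kind similarity measure solution $$\mu_t(x)=\frac{1}{R(t)^d}\,\mu_0\!\left(\frac{x}{R(t)}\right)$$ with $$\hat\mu_0=\sum_{k=1}^n m_k\delta_{\rho_k}$$ for some positive constants $m_k,\rho_k$, $k=1,\dots,n$, satisfying $\sum_{k=1}^n m_k=1$ and $0<\rho_1<\rho_2<\dots<\rho_n<\infty$.
   Context: Aggregation equation: $u_t+\operatorname{div}(uv)=0$, $v=-\nabla K*u$ for $x\in\mathbb{R}^d$, $t>0$, with $\nabla K(x)=x|x|^{\alpha-2}$. Let $\mathscr{P}(\mathbb{R}^d)$ be the set of probability measures on $\mathbb{R}^d$. For a radially symmetric $\mu\in\mathscr{P}(\mathbb{R}^d)$, $\hat\mu\in\mathscr{P}([0,\infty))$ is defined by $\hat\mu(I)=\mu(\{x\in\mathbb{R}^d:|x|\in I\})$ for all Borel sets $I\subset[0,\infty)$. The notation $\mu_t(x)=R(t)^{-d}\mu_0(x/R(t))$ means that $\mu_t$ is the push-forward of $\mu_0$ under the dilation $x\mapsto R(t)x$. Velocity of a radially symmetric measure: for radially symmetric $\mu\in\mathscr{P}(\mathbb{R}^d)$ and $x\neq 0$, the velocity $-\nabla K*\mu$ at $x$ is $$V[\mu](x)=-\int_{\mathbb{R}^d}(x-y)|x-y|^{\alpha-2}\,d\mu(y)=-\left(\int_{[0,\infty)}\phi(|x|/\rho)\rho^{\alpha-1}\,d\hat\mu(\rho)\right)\frac{x}{|x|},$$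 where $\phi(r)$, $r\ge 0$, is the average over the unit sphere $S_1=\{y\in\mathbb{R}^d:|y|=1\}$ (with respect to normalized surface measure; for $d=1$, the average over $\{-1,1\}$) of $\frac{r-y_1}{|re_1-y|^{2-\alpha}}$, $e_1=(1,0,\dots,0)$ (for $d=1$ the integrand is taken to be $0$ where $re_1=y$); at $\rho=0$ the integrand is understood as $|x|^{\alpha-1}$. At the origin $V[\mu](0)=0$ by symmetry. A radially symmetric first-kind similarity measure solution is a family $\mu_t$ of the form $\mu_t(x)=R(t)^{-d}\mu_0(x/R(t))$, where $\mu_0\in\mathscr{P}(\mathbb{R}^d)$ is radially symmetric and $R>0$ is a differentiable function on a time interval $[0,T_0)$ with $R(0)=1$, such that for every $x\in\operatorname{supp}\mu_0$ the flow map of the velocity field $v(t,\cdot)=V[\mu_t]$ (assumed finite on $\operatorname{supp}\mu_t$) starting at $x$ equals $R(t)x$ at time $t$, i.e. $\frac{d}{dt}(R(t)x)=v(t,R(t)x)$. For $\mu_0\neq\delta_0$ this is equivalent to: $V[\mu_0](x)=-\lambda x$ on $\operatorname{supp}\mu_0$ with some constant $\lambda>0$, and $R(t)=(1-t/T_0)^{1/(2-\alpha)}$ with $T_0=(2-\alpha)^{-1}\lambda^{-1}$. *)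

(* Defs.v *)
From HB Require Import structures.
From mathcomp Require Import all_boot all_order all_algebra.
From mathcomp Require Import all_classical all_reals all_analysis.

Set Implicit Arguments.
Unset Strict Implicit.
Unset Printing Implicit Defensive.

Import Order.TTheory GRing.Theory Num.Theory.
Import numFieldNormedType.Exports.
Local Open Scope classical_set_scope.
Local Open Scope ring_scope.

(* R^d with its Borel sets.  The norm of the normed module 'rV[R]_d is the sup
   norm: it is used only through its topology, which is the Euclidean one. *)
Notation borel_rV R d := (g_sigma_algebraType (@open 'rV[R]_d)).

Definition enorm (R : realType) (d : nat) (x : 'rV[R]_d) : R :=
  Num.sqrt (\sum_(i < d) x 0 i ^+ 2).

(* Invariance under the whole group O(d), which is {1, -1} for d = 1. *)
Definition radially_symmetric (R : realType) (d : nat)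
    (mu : probability (borel_rV R d) R) : Prop :=
  forall Q : 'M[R]_d, Q *m Q^T = 1%:M ->
  forall A : set (borel_rV R d), measurable A ->
    mu ((fun x : 'rV[R]_d => x *m Q) @^-1` A) = mu A.

(* The measure written with a hat: it is carried by [0, +oo[, so only its
   values on Borel subsets of [0, +oo[ matter. *)
Definition radial_part (R : realType) (d : nat)
    (mu : probability (borel_rV R d) R) : set R -> \bar R :=
  pushforward mu (@enorm R d : borel_rV R d -> R).

Definition msupport (R : realType) (d : nat)
    (mu : probability (borel_rV R d) R) : set 'rV[R]_d :=
  [set x | forall U : set 'rV[R]_d, open U -> U x -> (0 < mu U)%E].

(* gradK alpha 0 = 0, because 0 `^ p = 0 for p != 0 and the other factor
   vanishes too. *)
Definition gradK (R : realType) (d : nat) (alpha : R) (x : 'rV[R]_d) :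
    'rV[R]_d :=
  enorm x `^ (alpha - 2) *: x.

Definition velocity_finite (R : realType) (d : nat) (alpha : R)
    (mu : probability (borel_rV R d) R) (x : 'rV[R]_d) : Prop :=
  x != 0 -> forall i : 'I_d,
    mu.-integrable [set: borel_rV R d]
      (fun y : borel_rV R d => (gradK alpha (x - y) 0 i)%:E).

(* Integrals are taken coordinatewise; the value at the origin is 0 by
   symmetry, even when the integral there diverges. *)
Definition velocity (R : realType) (d : nat) (alpha : R)
    (mu : probability (borel_rV R d) R) (x : 'rV[R]_d) : 'rV[R]_d :=
  if x == 0 then 0 else
  - \row_(i < d)
      Rintegral mu [set: borel_rV R d]
        (fun y : borel_rV R d => gradK alpha (x - y) 0 i).

(* f has derivative l at t relative to D (one-sided at an endpoint of D). *)
Definition has_deriv_within (R : realType) (V : normedModType R) (D : set R)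
    (f : R -> V) (t : R) (l : V) : Prop :=
  (s - t)^-1 *: (f s - f t) @[s --> within D t^'] --> l.

(* mu t is the push-forward of mu 0 under x |-> r t *: x, and every point x of
   the support of mu 0 is transported to r t *: x by the flow of the velocity
   field of mu t. The values of mu and r outside [0, T0[ are irrelevant. *)
Definition first_kind_similarity_solution (R : realType) (d : nat) (alpha : R)
    (mu : R -> probability (borel_rV R d) R) (r : R -> R) (T0 : R) : Prop :=
  [/\ 0 < T0,
      radially_symmetric (mu 0),
      [/\ r 0 = 1,
          forall t, 0 <= t < T0 -> 0 < r t
        & forall t, 0 <= t < T0 ->
            exists l : R, has_deriv_within `[0, T0[ (r : R -> R^o) t l],
      forall t, 0 <= t < T0 ->
        forall A : set (borel_rV R d), measurable A ->
          mu t A = pushforward (mu 0)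
                     ((fun x => r t *: x) : borel_rV R d -> borel_rV R d) A
    & forall t, 0 <= t < T0 ->
        (forall x, msupport (mu t) x -> velocity_finite alpha (mu t) x) /\
        (forall x, msupport (mu 0) x ->
           has_deriv_within `[0, T0[ (fun s => r s *: x) t
             (velocity alpha (mu t) (r t *: x)))].

(* Main.v *)
From HB Require Import structures.
Require Import Defs.
From mathcomp Require Import all_boot all_order all_algebra.
From mathcomp Require Import all_classical all_reals all_analysis.
From mathcomp Require Import measurable_realfun ring lra zify.

Set Implicit Arguments.
Unset Strict Implicit.
Unset Printing Implicit Defensive.

Import Order.TTheory GRing.Theory Num.Theory.
Import numFieldNormedType.Exports.
Local Open Scope classical_set_scope.
Local Open Scope ring_scope.

(* The rings are placed at radii rho_k = t^(n-k), with t small. Write Phi(r) for the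
   radial component, at distance r from the centre, of gradK convolved with the
   uniform probability on the unit sphere, and g(r) = Phi(r)/r. The velocity of
   sum_k m_k (ring of radius rho_k) is -lambda x on the rings if and only if the
   weights a_k = m_k rho_k^(alpha-2) solve sum_k g(rho_j/rho_k) a_k = lambda for
   every j. As t -> 0 this system becomes upper triangular, with g(1) on the
   diagonal, g(0+) = (alpha-2+d)/d above it and 0 = g(+oo) below it; its solution
   is positive as soon as g(0+) < g(1), and positivity persists for small t.

   The inequality g(0+) < g(1) follows from the divergence identity
   Phi' + (d-1) Phi/r = (alpha-2+d) W for 0 < r < 1, where W(r) is the average over
   the unit sphere of |r e - y|^(alpha-2). The same identity with alpha-2 instead of
   alpha, whose factor alpha-4+d is negative, shows that W increases; so W > W(0) = 1
   and r^(d-1) Phi(r) - g(0+) r^d increases from 0. It remains to let r -> 1.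

   The uniform probability on the sphere is obtained by projecting Lebesgue
   measure on a shell; its rotation invariance comes from the uniqueness of
   translation-invariant measures. *)

(** * Lebesgue measure on row vectors *)

(** When [alpha < 1] the kernel is singular on the ring that feels it, so the value of the force at
    radius 1 is reached by dominated convergence from inside. Besides invariance and being carried
    by the sphere, the only fact used about the uniform measure is quantitative: a cap of radius eps
    has mass O(eps^(d-1)). Together with [alpha > 2 - d] it makes |e - y|^(alpha-1) integrable on
    the sphere.

    The divergence identity is obtained pointwise, without a flux argument: the diagonal of the
    Jacobian of the field is computed under the integral sign at a point of the axis. The axial
    entry is Phi', radiality forces every other entry to be Phi/r, and the trace of the Jacobian of
    the kernel is explicit.

    The shrinking law comes from homogeneity: the kernel has degree alpha - 1, so a profile with
    velocity -lambda x contracts by a factor r with r' = -lambda r^(alpha-1), which vanishes at time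
    1/((2-alpha) lambda).

    From the uniform measure on, the ambient dimension is written [d.+1] to have a distinguished
    axis [ord0]; the sphere then has dimension [d]. *)

Lemma measurable_coord (R : realType) (d : nat) (i : 'I_d) :
  measurable_fun [set: borel_rV R d] (fun x : borel_rV R d => (x : 'rV[R]_d) 0 i).
Proof.
apply: (measurability (@RGenOInfty.G R)); first exact: RGenOInfty.measurableE.
move=> _ [_ [a ->] <-]; rewrite setTI; apply: sub_sigma_algebra => /=.
have oa : open (`]a, +oo[%classic : set R) by exact: rray_open.
exact: (open_comp (fun x _ => @coord_continuous R 1 d 0 i x) oa).
Qed.

(** An open set is a countable union of rational cubes, and the preimage of a cube is a finite
    intersection of coordinate preimages. *)
Lemma measurable_rV (R : realType) (d : nat) disp (T : measurableType disp)
    (f : T -> borel_rV R d) :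
  (forall i, measurable_fun setT (fun x => (f x : 'rV[R]_d) 0 i)) ->
  measurable_fun setT f.
Proof.
move=> mf; apply: (@measurability _ _ _ (borel_rV R d) setT f (@open ('rV[R]_d))) => //.
move=> _ [U oU <-]; rewrite setTI.
pose B (q : 'rV[rat]_d * rat) : set 'rV[R]_d :=
  [set x | forall i, ratr (q.1 0 i) - ratr q.2 < x 0 i < ratr (q.1 0 i) + ratr q.2].
have -> : f @^-1` U = \bigcup_(q in [set q | B q `<=` U]) f @^-1` (B q).
  apply/seteqP; split=> [x Ux|x [q qU Bx]]; last exact: qU.
  have [e /= e0 eU] := (nbhs_ballP _ _).1 (oU (f x : 'rV[R]_d) Ux).
  (* The rational centre is off by less than [r] and the cube has half-side [r], hence the condition
     on [r + r]. *)
  have [r /andP[r0 re]] : exists r : rat, (0 < ratr r :> R) && (ratr r + ratr r < e).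
    have /rat_in_itvoo[q] : (0 < e / 2) by lra.
    by rewrite in_itv/= => /andP[q0 qe]; exists q; apply/andP; split; lra.
  have /choice[q qP] : forall i, exists q : rat,
      `|ratr q - (f x : 'rV[R]_d) 0 i| < ratr r.
    move=> i; have /rat_in_itvoo[q] :
      (f x : 'rV[R]_d) 0 i - ratr r < (f x : 'rV[R]_d) 0 i + ratr r by lra.
    by rewrite in_itv/= => qq; exists q; rewrite ltr_distl; lra.
  exists (\row_i q i, r) => /=.
    move=> y By; apply: eU; split => // i j; rewrite ord1 /ball/=.
    have := By j; have := qP j; rewrite /= !mxE ltr_distl.
    by rewrite ltr_distl => /andP[? ?] /andP[? ?]; apply/andP; split; lra.
  move=> i; have := qP i; rewrite /= !mxE ltr_distl => /andP[? ?].
  by apply/andP; split; lra.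
rewrite bigcup_mkcond; apply: countable_bigcupT_measurable => [|q].
  exact: countableP.
case: ifP => // _.
have -> : f @^-1` B q = \bigcap_(i in [set: 'I_d])
    ((fun x => (f x : 'rV[R]_d) 0 i) @^-1`
      `]ratr (q.1 0 i) - ratr q.2, ratr (q.1 0 i) + ratr q.2[%classic).
  apply/seteqP; split => [x Bx i _|x Bx i]; first by rewrite /= in_itv /=; exact: Bx.
  by have := Bx i I; rewrite /= in_itv.
apply: fin_bigcap_measurable => // i _.
by rewrite -[X in measurable X]setTI; apply: mf.
Qed.

Lemma lebesgue_measure_translation (R : realType) (a : R) (A : set R) :
  measurable A ->
  lebesgue_measure ((fun x => x + a) @^-1` A) = lebesgue_measure A :> \bar R.
Proof.
move=> mA.
have mt : measurable_fun [set: R] ((fun x => x + a) : R -> measurableTypeR R).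
  by apply: measurable_funD.
apply/esym/(@lebesgue_measure_unique R (pushforward lebesgue_measure
  ((fun x => x + a) : R -> measurableTypeR R))) => //= _ [[u v]] _ <-.
rewrite /pushforward.
have -> : (fun x => x + a) @^-1` [set` `]u, v]] = [set` `]u - a, v - a]].
  by apply/seteqP; split=> x /=; rewrite !in_itv/= lerBrDr ltrBlDr.
by rewrite !lebesgue_measure_itv/= !lte_fin ltrD2r -!EFinB; case: ifP => // _; congr EFin; ring.
Qed.

(** The measurability proof is an argument, so that the image comes as a bundled measure to which
    integration lemmas apply. *)
Definition push_measure {d1 d2 : measure_display} {T1 : measurableType d1}
    {T2 : measurableType d2} {R : realType} (m : {measure set T1 -> \bar R})
    {f : T1 -> T2} (mf : measurable_fun setT f) : {measure set T2 -> \bar R} :=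
  measure_function_pushforward__canonical__measure_function_Measure m mf.

Definition rV_cons {R : realType} {d : nat} (p : measurableTypeR R * borel_rV R d) :
    borel_rV R d.+1 :=
  (\row_(i < d.+1) if unlift ord0 i is Some j then (p.2 : 'rV[R]_d) 0 j else p.1)
    : 'rV[R]_d.+1.

Lemma measurable_rV_cons (R : realType) (d : nat) :
  measurable_fun setT (@rV_cons R d).
Proof.
apply: measurable_rV => i; rewrite /rV_cons.
case: (unliftP ord0 i) => [j ->|->].
  apply: (eq_measurable_fun (fun p : measurableTypeR R * borel_rV R d => (p.2 : 'rV[R]_d) 0 j)).
    by move=> p _; rewrite mxE liftK.
  exact: (measurableT_comp (@measurable_coord R d j) measurable_snd).
apply: (eq_measurable_fun (fun p : measurableTypeR R * borel_rV R d => p.1)) => //.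
  by move=> p _; rewrite mxE unlift_none.
exact: measurable_fst.
Qed.

Definition box {R : realType} {d : nat} (a b : 'I_d -> R) : set (borel_rV R d) :=
  [set x | forall i, a i <= (x : 'rV[R]_d) 0 i <= b i].

Lemma measurable_box (R : realType) (d : nat) (a b : 'I_d -> R) :
  measurable (box a b).
Proof.
have -> : box a b = \bigcap_(i in [set: 'I_d])
    ((fun x : borel_rV R d => (x : 'rV[R]_d) 0 i) @^-1` `[a i, b i]%classic).
  apply/seteqP; split => [x Bx i _|x Bx i]; first by rewrite /= in_itv /=; exact: Bx.
  by have := Bx i I; rewrite /= in_itv.
apply: fin_bigcap_measurable => // i _.
by rewrite -[X in measurable X]setTI; apply: measurable_coord.
Qed.

Definition translation_invariant {R : realType} {d : nat}
    (mu : set (borel_rV R d) -> \bar R) : Prop :=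
  forall (v : 'rV[R]_d) (A : set (borel_rV R d)), measurable A ->
    mu ((fun x : 'rV[R]_d => x + v) @^-1` A) = mu A.

Lemma box_sigma_finite (R : realType) (d : nat)
    (mu : {measure set (borel_rV R d) -> \bar R}) :
  (forall a b : 'I_d -> R, (forall i, a i <= b i) ->
     mu (box a b) = (\prod_i (b i - a i))%:E) ->
  sigma_finite setT mu.
Proof.
move=> mubox; exists (fun n => box (fun=> - n%:R) (fun=> n%:R)).
  apply/esym/seteqP; split => // x _.
  have xb i : `|(x : 'rV[R]_d) 0 i| <= \sum_j `|(x : 'rV[R]_d) 0 j|.
    by rewrite (bigD1 i)//= lerDl sumr_ge0.
  exists (Num.truncn (\sum_j `|(x : 'rV[R]_d) 0 j|)).+1 => //= i; rewrite -ler_norml.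
  by apply: (le_trans (xb i)); apply/ltW/truncnS_gt.
move=> n; split; first exact: measurable_box.
by rewrite mubox ?ltry// => i; rewrite (@le_trans _ _ 0)// oppr_le0.
Qed.

(** Induction on the dimension: the one-point space carries a Dirac mass, and each step pushes a
    product measure through [rV_cons]. A translation acts on each factor of a rectangle separately,
    so invariance follows from the uniqueness of product measures. *)
Lemma lebesgue_rV_exists (R : realType) (d : nat) :
  exists mu : {sigma_finite_measure set (borel_rV R d) -> \bar R},
    translation_invariant mu /\
    (forall a b : 'I_d -> R, (forall i, a i <= b i) ->
     mu (box a b) = (\prod_i (b i - a i))%:E).
Proof.
elim: d => [|d [mu [tmu bmu]]].
  exists (\d_((0 : 'rV[R]_0) : borel_rV R 0)); split.
    by move=> v A mA; congr (dirac _ _); apply/seteqP; split=> x /=;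
      rewrite (_ : x + v = x)//; apply/rowP => -[].
  move=> a b _; rewrite big_ord0 [LHS](@diracE _ _ R) mem_set//= => -[]//.
pose nu0 : {measure set (borel_rV R d.+1) -> \bar R} :=
  push_measure (lebesgue_measure \x mu)%E (@measurable_rV_cons R d).
have bnu a b : (forall i, a i <= b i) -> nu0 (box a b) = (\prod_i (b i - a i))%:E.
  move=> ab; rewrite /nu0/= /pushforward.
  have -> : rV_cons @^-1` box a b =
      `[a ord0, b ord0]%classic `*` box (a \o lift ord0) (b \o lift ord0).
    apply/seteqP; split => [[x y] /= h|[x y] [/= hx hy] i]; last first.
      rewrite /rV_cons mxE; case: (unliftP ord0 i) => [j ->|->] /=.
        exact: hy.
      by move: hx; rewrite in_itv.
    split=> [|i]; first by have := h ord0; rewrite /rV_cons mxE unlift_none in_itv.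
    by have := h (lift ord0 i); rewrite /rV_cons mxE liftK.
  rewrite product_measure1E//; last exact: measurable_box.
  rewrite bmu; last by move=> i; exact: ab.
  rewrite /=.
  rewrite lebesgue_measure_itv/= lte_fin big_ord_recl EFinM.
  case: ltP => // ba; suff -> : b ord0 - a ord0 = 0 by rewrite !mul0e.
  by apply/eqP; rewrite subr_eq0 eq_le ba ab.
(* Sigma-finiteness is bundled in because the next dimension takes a product with this measure. *)
pose H := Measure_isSigmaFinite.Build _ _ _ _ (box_sigma_finite bnu).
pose nu := HB.pack_for {sigma_finite_measure set (borel_rV R d.+1) -> \bar R}
  (Measure.sort nu0) H.
exists nu; split => // v A mA.
rewrite /nu /= /nu0 /= /pushforward.
pose a := v 0 ord0; pose w : 'rV[R]_d := \row_i v 0 (lift ord0 i).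
pose t (p : measurableTypeR R * borel_rV R d) : measurableTypeR R * borel_rV R d :=
  (p.1 + a : R, (p.2 : 'rV[R]_d) + w).
have mt : measurable_fun setT t.
  apply: measurable_fun_pair; first by apply: measurable_funD.
  apply: measurable_rV => i.
  apply: (eq_measurable_fun (fun p : measurableTypeR R * borel_rV R d =>
    (p.2 : 'rV[R]_d) 0 i + w 0 i)).
    by move=> p _; rewrite [RHS]mxE.
  apply: measurable_funD => //.
  exact: (measurableT_comp (@measurable_coord R d i) measurable_snd).
have -> : @rV_cons R d @^-1` ((fun x : 'rV[R]_d.+1 => x + v) @^-1` A) =
    t @^-1` (@rV_cons R d @^-1` A).
  apply/seteqP; split => p /=; rewrite (_ : rV_cons p + v = rV_cons (t p))//;
  apply/rowP => i; rewrite !mxE; case: (unliftP ord0 i) => [j ->|->] //;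
  by rewrite /= !mxE.
have mB : measurable (@rV_cons R d @^-1` A).
  by rewrite -[X in measurable X]setTI; exact: measurable_rV_cons.
have := @product_measure_unique _ _ _ _ R lebesgue_measure mu
  (push_measure (lebesgue_measure \x mu)%E mt).
move=> /(_ _ _ mB) /esym; apply => B C mB' mC.
rewrite /= /pushforward.
have -> : t @^-1` (B `*` C) =
  ((fun x => x + a) @^-1` B) `*` ((fun x : 'rV[R]_d => x + w) @^-1` C) by [].
rewrite product_measure1E//.
- move=> /=; by rewrite lebesgue_measure_translation// tmu.
- by rewrite -[X in measurable X]setTI; exact: measurable_funD.
- rewrite -[X in measurable X]setTI.
  suff : measurable_fun setT ((fun x : 'rV[R]_d => x + w) : borel_rV R d -> borel_rV R d) by exact.
  apply: measurable_rV => i.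
  apply: (eq_measurable_fun (fun x : borel_rV R d => (x : 'rV[R]_d) 0 i + w 0 i)).
    by move=> p _; rewrite [RHS]mxE.
  by apply: measurable_funD => //; exact: measurable_coord.
Qed.

(** * Uniqueness of translation-invariant measures *)

(** Tonelli for an indicator: the two iterated integrals are measures in [E] that agree on
    rectangles. *)
Lemma product_sections (R : realType) (d1 d2 : measure_display)
    (T1 : measurableType d1) (T2 : measurableType d2)
    (mu : {sigma_finite_measure set T1 -> \bar R})
    (nu : {sigma_finite_measure set T2 -> \bar R}) (E : set (T1 * T2)) :
  measurable E ->
  (\int[mu]_x nu (xsection E x) = \int[nu]_y mu (ysection E y))%E.
Proof.
move=> mE.
apply: (@product_measure_unique _ _ _ _ R mu nu (mu \x^ nu)%E _ E mE) => A B mA mB.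
exact: product_measure2E.
Qed.

Lemma preimage_measurable {d1 d2} {T1 : measurableType d1} {T2 : measurableType d2}
    (f : T1 -> T2) (A : set T2) :
  measurable_fun setT f -> measurable A -> measurable (f @^-1` A).
Proof. by move=> mf mA; rewrite -[X in measurable X]setTI; exact: mf. Qed.

Section haar.
Variables (R : realType) (d : nat).
Local Notation T := (borel_rV R d).

Lemma measurable_rV_add : measurable_fun [set: T * T]
  (fun p => (p.1 : 'rV[R]_d) + (p.2 : 'rV[R]_d) : T).
Proof.
apply: measurable_rV => i.
apply: (eq_measurable_fun (fun p : T * T =>
    (p.1 : 'rV[R]_d) 0 i + (p.2 : 'rV[R]_d) 0 i)) => [p _|].
  by rewrite [RHS]mxE.
apply: measurable_funD.
  exact: (measurableT_comp (@measurable_coord R d i) measurable_fst).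
exact: (measurableT_comp (@measurable_coord R d i) measurable_snd).
Qed.

Lemma measurable_rV_sub : measurable_fun [set: T * T]
  (fun p => (p.2 : 'rV[R]_d) - (p.1 : 'rV[R]_d) : T).
Proof.
apply: measurable_rV => i.
apply: (eq_measurable_fun (fun p : T * T =>
    (p.2 : 'rV[R]_d) 0 i - (p.1 : 'rV[R]_d) 0 i)) => [p _|].
  by rewrite !mxE.
apply: measurable_funB.
  exact: (measurableT_comp (@measurable_coord R d i) measurable_snd).
exact: (measurableT_comp (@measurable_coord R d i) measurable_fst).
Qed.

(* Both sides are the mu (x) nu-measure of {(x, y) | x + y in A, y in B},
   computed in the two orders. *)
Lemma translation_invariant_unique (mu nu : {sigma_finite_measure set T -> \bar R})
    (A B : set T) :
  translation_invariant mu -> translation_invariant nu ->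
  measurable A -> measurable B -> (forall x : 'rV[R]_d, B x -> B (- x)) ->
  (mu A * nu B = nu A * mu B)%E.
Proof.
move=> tmu tnu mA mB Bsym.
pose E : set (T * T) := (fun p => (p.1 : 'rV[R]_d) + (p.2 : 'rV[R]_d) : T) @^-1` A
   `&` snd @^-1` B.
(* [F] is the image of [E] under (x, y) -> (x, x + y), so their x-sections are translates of each
   other. Its y-section over a point of [A] is y - B, a translate of [B] by symmetry. *)
pose F : set (T * T) := snd @^-1` A `&`
  (fun p => (p.2 : 'rV[R]_d) - (p.1 : 'rV[R]_d) : T) @^-1` B.
have mE : measurable E.
  by apply: measurableI; apply: preimage_measurable => //; exact: measurable_rV_add.
have mF : measurable F.
  by apply: measurableI; apply: preimage_measurable => //; exact: measurable_rV_sub.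
have -> : (mu A * nu B = \int[nu]_y mu (ysection E y))%E.
  rewrite -(integral_cst nu mB) integral_mkcond; apply: eq_integral => y _.
  rewrite patchE; case: ifPn => [/set_mem By|/negP By].
    rewrite -[LHS](tmu y A mA); congr (mu _).
    apply/seteqP; split => x; rewrite /ysection/= inE/=; first by move=> ?; split.
    by case.
  rewrite (_ : ysection E y = set0) ?measure0//.
  by apply/seteqP; split => x //; rewrite /ysection/= inE/= => -[_ /mem_set].
have -> : (nu A * mu B = \int[nu]_y mu (ysection F y))%E.
  rewrite muleC -(integral_cst nu mA) integral_mkcond; apply: eq_integral => y _.
  rewrite patchE; case: ifPn => [/set_mem Ay|/negP Ay].
    rewrite -[LHS](tmu (- y) B mB); congr (mu _).
    apply/seteqP; split => x; rewrite /ysection/= inE/=.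
      by move=> /Bsym ?; split => //=; rewrite -opprB.
    by move=> [_ /= /Bsym]; rewrite opprB.
  rewrite (_ : ysection F y = set0) ?measure0//.
  by apply/seteqP; split => x //; rewrite /ysection/= inE/= => -[/mem_set].
rewrite -!product_sections//; apply: eq_integral => x _.
rewrite -[RHS](tnu x); last by apply: measurable_xsection.
congr (nu _); apply/seteqP; split => y; rewrite /xsection/= !inE/=.
  by move=> [/= h1 h2]; split; rewrite /= ?addrK// addrC.
by move=> [/= h1]; rewrite addrK; split => //=; rewrite addrC.
Qed.
End haar.

(** * The Euclidean norm and rotation invariance of Lebesgue measure *)

Section enorm_theory.
Variables (R : realType) (d : nat).
Implicit Types x y : 'rV[R]_d.

Lemma sqr_enorm x : enorm x ^+ 2 = \sum_(i < d) x 0 i ^+ 2.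
Proof. by rewrite sqr_sqrtr// sumr_ge0// => i _; exact: sqr_ge0. Qed.

Lemma enorm_ge0 x : 0 <= enorm x.
Proof. exact: sqrtr_ge0. Qed.

Lemma enormZ (a : R) x : enorm (a *: x) = `|a| * enorm x.
Proof.
rewrite /enorm -sqrtr_sqr -sqrtrM ?sqr_ge0// mulr_sumr; congr Num.sqrt.
by apply: eq_bigr => i _; rewrite mxE exprMn.
Qed.

Lemma enormN x : enorm (- x) = enorm x.
Proof. by rewrite -scaleN1r enormZ normrN1 mul1r. Qed.

Lemma coord_le_enorm x i : `|x 0 i| <= enorm x.
Proof.
rewrite -sqrtr_sqr ler_wsqrtr// (bigD1 i)//= lerDl sumr_ge0// => j _.
exact: sqr_ge0.
Qed.

Lemma enorm_eq0 x : (enorm x == 0) = (x == 0).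
Proof.
apply/eqP/eqP => [x0|->]; last first.
  by rewrite /enorm big1 ?sqrtr0// => i _; rewrite mxE expr0n.
apply/rowP => i; rewrite mxE; apply/normr0_eq0/eqP.
by rewrite eq_le normr_ge0 andbT -x0 coord_le_enorm.
Qed.

Lemma sum_sqr_mul_trmx x : \sum_(i < d) x 0 i ^+ 2 = (x *m x^T) 0 0.
Proof. by rewrite mxE; apply: eq_bigr => i _; rewrite mxE. Qed.

Lemma enorm_orthogonal x (Q : 'M[R]_d) : Q *m Q^T = 1%:M ->
  enorm (x *m Q) = enorm x.
Proof.
move=> QQ; rewrite /enorm !sum_sqr_mul_trmx trmx_mul mulmxA.
by rewrite -(mulmxA x) QQ mulmx1.
Qed.

Lemma measurable_enorm :
  measurable_fun [set: borel_rV R d] (@enorm R d : borel_rV R d -> R).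
Proof.
have ms : measurable_fun setT (@Num.sqrt R).
  by apply: continuous_measurable_fun; exact: sqrt_continuous.
apply: (measurableT_comp ms).
apply: measurable_sum => i; apply: measurable_funX; exact: measurable_coord.
Qed.

Lemma measurable_linear_rV (Q : 'M[R]_d) :
  measurable_fun setT ((fun x : 'rV[R]_d => x *m Q) : borel_rV R d -> borel_rV R d).
Proof.
apply: measurable_rV => i.
apply: (eq_measurable_fun (fun x : borel_rV R d =>
    \sum_j (x : 'rV[R]_d) 0 j * Q j i)) => [x _|].
  by rewrite [RHS]mxE.
by apply: measurable_sum => j; apply: measurable_funM => //; exact: measurable_coord.
Qed.

Lemma measurable_enorm_set (B : set R) : measurable B ->
  measurable [set x : borel_rV R d | B (enorm (x : 'rV[R]_d))].
Proof. exact: (preimage_measurable measurable_enorm). Qed.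

End enorm_theory.

Definition eball {R : realType} {d : nat} (r : R) : set (borel_rV R d) :=
  [set x | enorm (x : 'rV[R]_d) <= r].

Lemma measurable_eball (R : realType) (d : nat) (r : R) : measurable (@eball R d r).
Proof.
rewrite /eball (_ : mkset _ =
  [set x : borel_rV R d | `]-oo, r]%classic (enorm (x : 'rV[R]_d))]).
  by apply: measurable_enorm_set.
by apply/seteqP; split => x; rewrite /= in_itv.
Qed.

Section orthogonal_invariance.
Variables (R : realType) (d : nat) (mu : {sigma_finite_measure set (borel_rV R d) -> \bar R}).
Hypotheses (tmu : translation_invariant mu)
  (mubox : forall a b : 'I_d -> R, (forall i, a i <= b i) ->
     mu (box a b) = (\prod_i (b i - a i))%:E).

Lemma eball_lty (r : R) : 0 <= r -> (mu (eball r) < +oo)%E.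
Proof.
move=> r0; have: (mu (eball r) <= mu (box (fun=> (- r)%R) (fun=> r)))%E.
  apply: le_measure; rewrite ?inE; [exact: measurable_eball|exact: measurable_box|].
  move=> x /= xr i; rewrite -ler_norml; exact: le_trans (coord_le_enorm _ _) xr.
by move/le_lt_trans; apply; rewrite mubox ?ltry// => i; lra.
Qed.

Lemma eball1_gt0 : (0 < mu (eball 1))%E.
Proof.
(* The cube of half-side 1/(d+1) lies in the unit ball because d/(d+1)^2 <= 1; the successor keeps
   the inverse meaningful for [d = 0]. *)
pose c : R := d.+1%:R^-1.
have c0 : 0 < c by rewrite invr_gt0 ltr0n.
apply: (@lt_le_trans _ _ (mu (box (fun=> (- c)%R) (fun=> c)))).
  by rewrite mubox ?lte_fin; [apply: prodr_gt0 => i _; lra|move=> i; lra].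
apply: le_measure; rewrite ?inE; [exact: measurable_box|exact: measurable_eball|].
move=> x /= xc; rewrite /eball/= -(@ler_pXn2r _ 2) ?nnegrE ?enorm_ge0// sqr_enorm expr1n.
apply: (@le_trans _ _ (\sum_(i < d) c ^+ 2)).
  by apply: ler_sum => i _; rewrite -real_normK ?num_real// ler_pXn2r ?nnegrE ?(ltW c0)// ler_norml.
rewrite sumr_const card_ord -[leLHS]mulr_natr /c exprVn -mulrC ler_pdivrMr ?mul1r.
  by rewrite -natrX ler_nat expnS expn1 (leq_trans (leqnSn d))// leq_pmulr.
by rewrite exprn_gt0// ltr0n.
Qed.

(** The image of [mu] under [Q] is again translation invariant, hence proportional to [mu]; the unit
    ball is stable under [Q] and has positive finite measure, so the ratio is 1. *)
Lemma lebesgue_rV_orthogonal (Q : 'M[R]_d) (A : set (borel_rV R d)) :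
  Q *m Q^T = 1%:M -> measurable A ->
  mu ((fun x : 'rV[R]_d => x *m Q) @^-1` A) = mu A.
Proof.
move=> QQ mA.
have QtQ : Q^T *m Q = 1%:M by rewrite mulmx1C.
pose nu0 := push_measure mu (measurable_linear_rV Q).
have nuball r : nu0 (eball r) = mu (eball r).
  by congr (mu _); apply/seteqP; split => x; rewrite /eball/= enorm_orthogonal.
have snu : sigma_finite setT nu0.
  exists (fun n => eball n%:R).
    apply/esym/seteqP; split => // x _.
    exists (Num.truncn (enorm (x : 'rV[R]_d))).+1 => //.
    by rewrite /eball/=; apply/ltW/truncnS_gt.
  move=> n; split; first exact: measurable_eball.
  by rewrite nuball eball_lty.
pose H := Measure_isSigmaFinite.Build _ _ _ _ snu.
pose nu := HB.pack_for {sigma_finite_measure set (borel_rV R d) -> \bar R}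
  (Measure.sort nu0) H.
have tnu : translation_invariant nu.
  move=> v B mB.
  have -> : nu ((fun x => x + v) @^-1` B) =
      mu ((fun x : 'rV[R]_d => x + v *m Q^T) @^-1` ((fun x : 'rV[R]_d => x *m Q) @^-1` B)).
    congr (mu _); apply/seteqP; split => x /=;
    by rewrite mulmxDl -mulmxA QtQ mulmx1.
  rewrite tmu//; exact: (preimage_measurable (measurable_linear_rV Q)).
have := translation_invariant_unique tmu tnu mA (@measurable_eball R d 1).
have -> : nu (eball 1) = mu (eball 1) by exact: nuball.
move=> /(_ _)/esym H1.
have /H1 : forall x : 'rV[R]_d, (@eball R d 1) x -> (@eball R d 1) (- x).
  by move=> x; rewrite /eball/= enormN.
rewrite -(@fineK _ (mu (eball 1))) ?ge0_fin_numE ?eball_lty//.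
have c0 : fine (mu (eball 1)) != 0.
  by rewrite gt_eqF// fine_gt0// eball1_gt0 eball_lty.
move=> /(congr1 (fun z => z * ((fine (mu (eball 1)))^-1)%:E)%E).
by rewrite -!muleA -EFinM divff// !mule1.
Qed.

End orthogonal_invariance.

(** * The uniform measure on the unit sphere *)

Lemma mnormalizeE (d : measure_display) (T : measurableType d) (R : realType)
    (mu : {measure set T -> \bar R}) (P : probability T R) (A : set T) :
  (0 < mu setT < +oo)%E -> mnormalize mu P A = (mu A * ((fine (mu setT))^-1)%:E)%E.
Proof. by move=> /andP[m0 my]; rewrite /mnormalize gt_eqF//= lt_eqF. Qed.

Lemma measurable_normalize (R : realType) (d : nat) :
  measurable_fun [set: borel_rV R d]
    ((fun x : 'rV[R]_d => (enorm x)^-1 *: x) : borel_rV R d -> borel_rV R d).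
Proof.
apply: measurable_rV => i.
apply: (eq_measurable_fun (fun x : borel_rV R d =>
    (enorm (x : 'rV[R]_d) `^ (-1)) * (x : 'rV[R]_d) 0 i)) => [x _|].
  by rewrite mxE powR_inv1// enorm_ge0.
apply: measurable_funM; last exact: measurable_coord.
apply: (@measurableT_comp _ _ _ _ _ _ (fun t : R => t `^ (-1))).
  exact: measurable_powR.
exact: measurable_enorm.
Qed.

(** A full ball around the pole; a measure carried by the sphere only sees its trace there, which is
    a spherical cap. *)
Definition polar_cap {R : realType} {d : nat} (eps : R) : set (borel_rV R d.+1) :=
  [set x | enorm ((x : 'rV[R]_d.+1) - delta_mx 0 ord0) <= eps].

Lemma measurable_polar_cap (R : realType) (d : nat) (eps : R) : measurable (@polar_cap R d eps).
Proof.
pose e0 : 'rV[R]_d.+1 := delta_mx 0 ord0.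
have -> : @polar_cap R d eps = (fun x : 'rV[R]_d.+1 => x - e0) @^-1` (@eball R d.+1 eps).
  by [].
apply: (@preimage_measurable _ _ (borel_rV R d.+1) (borel_rV R d.+1)).
  apply: measurable_rV => i.
  apply: (eq_measurable_fun (fun x : borel_rV R d.+1 =>
    (x : 'rV[R]_d.+1) 0 i - e0 0 i)) => [x _|]; first by rewrite !mxE.
  by apply: measurable_funB => //; exact: measurable_coord.
exact: measurable_eball.
Qed.

(** The exponent [d] in the cap bound is the dimension of the sphere: a shell point projecting into
    the cap has its [d] transverse coordinates of order [eps]. *)
Lemma uniform_sphere_exists (R : realType) (d : nat) :
  exists sg : probability (borel_rV R d.+1) R,
    [/\ radially_symmetric sg,
        sg [set x | enorm (x : 'rV[R]_d.+1) = 1] = 1%E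
      & exists2 C : R, 0 <= C & forall eps, 0 <= eps ->
          (sg (polar_cap eps) <= (C * eps ^+ d)%:E)%E].
Proof.
have [mu [tmu mubox]] := lebesgue_rV_exists R d.+1.
pose S : set (borel_rV R d.+1) := [set x | `[1, 2]%classic (enorm (x : 'rV[R]_d.+1))].
have mS : measurable S by exact: measurable_enorm_set.
have S0 : (0 < mu S)%E.
  (* The shell contains the cube with corner at the pole and side c = 1/(d+1): the transverse
     squares add up to at most d c = 1 - c, and (1 + c)^2 + 1 - c <= 4. *)
  pose c : R := d.+1%:R^-1.
  have c0 : 0 < c by rewrite invr_gt0 ltr0n.
  have c1 : c <= 1 by rewrite invf_le1 ?ltr0n// ler1n.
  pose a i : R := (i == ord0 :> 'I_d.+1)%:R.
  pose b i : R := a i + c.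
  apply: (@lt_le_trans _ _ (mu (box a b))).
    rewrite mubox ?lte_fin; last by move=> i; rewrite /b lerDl ltW.
    by apply: prodr_gt0 => i _; rewrite /b addrC addKr.
  apply: le_measure; rewrite ?inE; [exact: measurable_box|exact: mS|].
  move=> x /= xc; rewrite /S/= in_itv/=.
  rewrite -[X in X <= enorm _](@ger0_norm _ 1)// -sqrtr_sqr expr1n.
  rewrite -(@ger0_norm _ 2)// -[`|2%:R|]sqrtr_sqr.
  have x0 : 1 <= (x : 'rV[R]_d.+1) 0 ord0.
    by have := xc ord0; rewrite /a eqxx => /andP[].
  have x0' : (x : 'rV[R]_d.+1) 0 ord0 <= 1 + c.
    by have := xc ord0; rewrite /b /a eqxx => /andP[].
  have xi (i : 'I_d) : (x : 'rV[R]_d.+1) 0 (lift ord0 i) ^+ 2 <= c.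
    have := xc (lift ord0 i); rewrite /b /a [lift _ _ == _]eq_sym (negbTE (neq_lift _ _)) add0r.
    move=> /andP[p0 pc]; rewrite expr2 -[leRHS]mulr1.
    by rewrite ler_pM// (le_trans pc).
  rewrite /enorm big_ord_recl !ler_wsqrtr//; last first.
    by rewrite -[leLHS]addr0 lerD ?sumr_ge0// => [|i _]; [rewrite exprn_ege1|exact: sqr_ge0].
  have : \sum_(i < d) (x : 'rV[R]_d.+1) 0 (lift ord0 i) ^+ 2 <= 1 - c.
    apply: (@le_trans _ _ (\sum_(i < d) c)); first exact: ler_sum.
    rewrite sumr_const card_ord -[leLHS]mulr_natr.
    rewrite -(@ler_pM2l _ d.+1%:R) ?ltr0n// mulrA /c divff ?pnatr_eq0// mulrBr mulr1.
    rewrite divff ?pnatr_eq0//.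
    by rewrite mul1r -natr1 addrK.
  nra.
have Sy : (mu S < +oo)%E.
  apply: (@le_lt_trans _ _ (mu (eball 2))); last by rewrite (eball_lty mubox).
  apply: le_measure; rewrite ?inE; [exact: mS|exact: measurable_eball|].
  by move=> x; rewrite /S/= in_itv/= => /andP[].
pose N : borel_rV R d.+1 -> borel_rV R d.+1 := fun x : 'rV[R]_d.+1 => (enorm x)^-1 *: x.
pose m := push_measure (mrestr mu mS) (@measurable_normalize R d.+1).
have mE A : m A = mu (N @^-1` A `&` S) by [].
have mT : m setT = mu S by rewrite mE preimage_setT setTI.
have m0y : (0 < m setT < +oo)%E by rewrite mT S0.
(* The Dirac mass is the fallback value of [mnormalize], never taken since [mu S] is positive and
   finite. *)
pose sg : probability (borel_rV R d.+1) R :=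
  mnormalize m (\d_((0 : 'rV[R]_d.+1) : borel_rV R d.+1)).
have sgE A : sg A = (mu (N @^-1` A `&` S) * ((fine (mu S))^-1)%:E)%E.
  by rewrite -mT -mE; exact: mnormalizeE.
have mN A : measurable A -> measurable (N @^-1` A `&` S).
  move=> mA; apply: measurableI => //.
  exact: (preimage_measurable (@measurable_normalize R d.+1)).
have fS0 : 0 < fine (mu S) by rewrite fine_gt0// S0.
exists sg; split.
- move=> Q QQ A mA; rewrite !sgE; congr (_ * _)%E.
  rewrite -[RHS](lebesgue_rV_orthogonal tmu mubox QQ); last exact: mN.
  congr (mu _); apply/seteqP; split => x; rewrite /N /S/= enorm_orthogonal//;
  by rewrite -scalemxAl.
- rewrite sgE (_ : _ `&` _ = S).
    by rewrite -{1}(@fineK _ (mu S)) ?ge0_fin_numE// -EFinM divff ?gt_eqF.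
  apply/seteqP; split => [x []//|x Sx]; split => //=; rewrite /N enormZ.
  move: Sx; rewrite /S/= in_itv/= => /andP[x1 _].
  have x0 : 0 < enorm (x : 'rV[R]_d.+1) by rewrite (lt_le_trans _ x1).
  by rewrite gtr0_norm ?invr_gt0// mulVf ?gt_eqF.
- exists (4 * 4 ^+ d / fine (mu S)); first by rewrite divr_ge0 ?(ltW fS0)// mulr_ge0// exprn_ge0.
  move=> eps eps0; rewrite sgE.
  rewrite mulrAC EFinM lee_wpmul2r// ?lee_fin ?invr_ge0 ?(ltW fS0)//.
  (* On the shell the norm is at most 2: the axial coordinate is bounded by 2, and a transverse one
     by 2 times that of the projection. The box has volume 4 (4 eps)^d. *)
  pose a i : R := if i == ord0 :> 'I_d.+1 then 2 else 2 * eps.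
  apply: (@le_trans _ _ (mu (box (fun i => (- a i)%R) a))).
    apply: le_measure; rewrite ?inE; [|exact: measurable_box|].
      by apply: mN; exact: measurable_polar_cap.
    move=> x [/= Nx]; rewrite /S/= in_itv/= => /andP[x1 x2] i.
    have x0 : 0 < enorm (x : 'rV[R]_d.+1) by rewrite (lt_le_trans _ x1).
    rewrite -ler_norml /a; case: eqP => [_|/eqP i0].
      exact: le_trans (coord_le_enorm _ _) x2.
    have : `|(N x : 'rV[R]_d.+1) 0 i| <= eps.
      apply: le_trans Nx; apply: le_trans (coord_le_enorm _ i).
      by rewrite !mxE eqxx/= (negbTE i0) subr0.
    rewrite mxE normrM gtr0_norm ?invr_gt0// mulrC ler_pdivrMr// => /le_trans; apply.
    by rewrite mulrC ler_wpM2r.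
  rewrite mubox; last by move=> i; rewrite /a; case: ifP => _; lra.
  rewrite lee_fin big_ord_recl {1 2}/a eqxx -mulrA -exprMn.
  rewrite (eq_bigr (fun=> 4 * eps)); last first.
    by move=> i _; rewrite /a [lift _ _ == _]eq_sym (negbTE (neq_lift _ _)); ring.
  by rewrite prodr_const card_ord le_eqVlt; apply/orP; left; apply/eqP;
    congr (_ * _); ring.
Qed.

(** * Differentiation under the integral sign *)

Section bounded_integrals.
Variables (disp : measure_display) (T : measurableType disp) (R : realType).
Variables (mu : {finite_measure set T -> \bar R}) (B : set T).
Hypothesis mB : measurable B.

Lemma bounded_integrable (f : T -> R) (K : R) :
  measurable_fun B f -> (forall y, B y -> `|f y| <= K) ->
  mu.-integrable B (EFin \o f).
Proof.
move=> mf fK; apply: measurable_bounded_integrable => //.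
  by rewrite -ge0_fin_numE// fin_num_measure.
exists K; split; first exact: num_real.
by move=> M KM y By; apply: (le_trans (fK y By)); exact: ltW.
Qed.

(** The measure is finite, so a uniform bound serves as the integrable majorant. *)
Lemma is_derive_integral (f f' : R -> T -> R) (a e K : R) : 0 < e ->
  (forall x, `|x - a| < e -> measurable_fun B (f x)) ->
  (forall x y, `|x - a| < e -> B y -> `|f x y| <= K) ->
  (forall x y, `|x - a| < e -> B y -> is_derive x 1 (f ^~ y) (f' x y)) ->
  (forall x y, `|x - a| < e -> B y -> `|f' x y| <= K) ->
  is_derive a 1 (fun x => \int[mu]_(y in B) f x y) (\int[mu]_(y in B) f' a y).
Proof.
move=> e0 mf fK df f'K.
have inI x : `]a - e, a + e[%classic x -> `|x - a| < e.
  by rewrite /= in_itv/= ltr_distl.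
have Ia : `]a - e, a + e[%classic a by rewrite /= in_itv/=; lra.
have intf x : `]a - e, a + e[%classic x -> mu.-integrable B (EFin \o f x).
  by move=> /inI xe; apply: (@bounded_integrable _ K); [exact: mf|move=> y; exact: fK].
have derf x y : `]a - e, a + e[%classic x -> B y -> derivable (f ^~ y) x 1.
  by move=> /inI xe By; have [] := df x y xe By.
have d1E x y : `]a - e, a + e[%classic x -> B y -> partial1of2 f x y = f' x y.
  by move=> /inI xe By; rewrite partial1of2E; have [_] := df x y xe By.
(* [K] can be negative when [B] is empty, while the majorant has to be nonnegative everywhere. *)
have G0 (y : T) : 0 <= `|K| by [].
have intG : mu.-integrable B (EFin \o (fun=> `|K|)).
  by apply: (@bounded_integrable _ `|K|) => // y _; rewrite normr_id.
have G_ub x y : `]a - e, a + e[%classic x -> B y -> `|partial1of2 f x y| <= `|K|.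
  move=> xI By; rewrite d1E//; apply: le_trans (ler_norm K).
  by apply: f'K => //; exact: inI.
apply: DeriveDef; first exact: (derivable_under_integral mB Ia intf derf G0 intG G_ub).
rewrite -derive1E (differentiation_under_integral mB Ia intf derf G0 intG G_ub).
by apply: eq_Rintegral => y /set_mem By; exact: d1E.
Qed.

End bounded_integrals.

(** The power is monotone in a direction given by the sign of [p]; adding both endpoint values
    covers the two cases at once. *)
Lemma powR_bound (R : realType) (p x l h : R) : 0 < l -> l <= x -> x <= h ->
  x `^ p <= l `^ p + h `^ p.
Proof.
move=> l0 lx xh; have x0 := lt_le_trans l0 lx; have h0 := lt_le_trans x0 xh.
have [p0|p0] := leP 0 p.
  apply: (@le_trans _ _ (h `^ p)); last by rewrite lerDr powR_ge0.
  by apply: ge0_ler_powR; rewrite ?nnegrE ?(ltW h0) ?(ltW x0).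
apply: (@le_trans _ _ (l `^ p)); last by rewrite lerDl powR_ge0.
rewrite -[p]opprK (powRN x) (powRN l) lef_pV2 ?posrE ?powR_gt0//.
by apply: ge0_ler_powR; rewrite ?nnegrE ?(ltW l0) ?(ltW x0)// oppr_ge0 ltW.
Qed.

Section quadratic_power.
Variables (disp : measure_display) (T : measurableType disp) (R : realType).
Variables (mu : {finite_measure set T -> \bar R}) (B : set T).
Hypothesis mB : measurable B.
Variables (a c q : T -> R) (b s t0 M e delta : R).
Hypotheses (e0 : 0 < e) (delta0 : 0 < delta).
Hypotheses (ma : measurable_fun B a) (mc : measurable_fun B c)
  (mq : measurable_fun B q).
Hypotheses (aM : forall y, B y -> `|a y| <= M) (cM : forall y, B y -> `|c y| <= M)
  (qM : forall y, B y -> `|q y| <= M).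
Hypothesis Qdelta : forall t y, `|t - t0| < e -> B y -> delta <= c y + q y * t + t ^+ 2.

Let Q t y := c y + q y * t + t ^+ 2.

(** Along a coordinate line the squared distance to [y] is a monic quadratic in [t]. The case
    [b = 1] gives a coordinate of the force, the case [a = 1], [b = 0] gives the potential. *)
Lemma is_derive_integral_quadratic_power :
  is_derive t0 1 (fun t => \int[mu]_(y in B) ((a y + b * t) * Q t y `^ s))
    (\int[mu]_(y in B) (b * Q t0 y `^ s +
        (a y + b * t0) * (s * Q t0 y `^ (s - 1) * (q y + 2 * t0)))).
Proof.

pose N := `|t0| + e.
have N0 : 0 <= N by rewrite addr_ge0 ?(ltW e0).
have tN t : `|t - t0| < e -> `|t| <= N.
  move=> te; have -> : t = t0 + (t - t0) by ring.
  by rewrite (le_trans (ler_normD _ _))// lerD2l ltW.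
have M0 y : B y -> 0 <= M by move=> By; exact: le_trans (normr_ge0 _) (aM By).
pose H := M + M * N + N ^+ 2.
have QH t y : `|t - t0| < e -> B y -> Q t y <= H.
  move=> te By; rewrite /Q /H; apply: (le_trans (ler_norm _)).
  apply: (le_trans (ler_normD _ _)); rewrite lerD//.
    apply: (le_trans (ler_normD _ _)); rewrite lerD// ?cM// normrM.
    by rewrite ler_pM// ?qM// tN.
  by rewrite normrX ler_pXn2r ?nnegrE// tN.
pose P p := delta `^ p + H `^ p.
have QP p t y : `|t - t0| < e -> B y -> `|Q t y `^ p| <= P p.
  move=> te By; rewrite ger0_norm ?powR_ge0//; apply: powR_bound => //.
    exact: Qdelta.
  exact: QH.
have P0 p : 0 <= P p by rewrite addr_ge0// powR_ge0.
pose A := M + `|b| * N.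
have aA t y : `|t - t0| < e -> B y -> `|a y + b * t| <= A.
  move=> te By; apply: (le_trans (ler_normD _ _)); rewrite lerD ?aM//.
  by rewrite normrM ler_wpM2l// tN.
(* [is_derive_integral] takes one constant for the integrand and its derivative, hence the sum of
   the two bounds. *)
pose K := A * P s + (`|b| * P s + A * (`|s| * P (s - 1) * (M + 2 * N))).
have A0 y : B y -> 0 <= A by move=> By; rewrite addr_ge0 ?mulr_ge0// (M0 y).
apply: (@is_derive_integral _ _ _ mu B mB (fun t y => (a y + b * t) * Q t y `^ s)
  (fun t y => b * Q t y `^ s +
        (a y + b * t) * (s * Q t y `^ (s - 1) * (q y + 2 * t))) t0 e K) => //.
- move=> t te; apply: measurable_funM.
    by apply: measurable_funD => //; exact: measurable_cst.
  apply: (@measurableT_comp _ _ _ _ _ _ (fun t : R => t `^ s)).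
    exact: measurable_powR.
  apply: measurable_funD => //; apply: measurable_funD => //.
  exact: measurable_funM.
- move=> t y te By; rewrite normrM.
  apply: (@le_trans _ _ (A * P s)); first by rewrite ler_pM// ?aA// QP.
  rewrite lerDl addr_ge0 ?mulr_ge0 ?(A0 y)// addr_ge0 ?mulr_ge0// (M0 y)//.
- move=> t y te By.
  have Q0 : 0 < Q t y by apply: lt_le_trans (Qdelta te By).
  have dQ : is_derive t 1 (Q ^~ y) (q y + 2 * t).
    rewrite /Q; apply: is_derive_eq; rewrite /GRing.scale/=; ring.
  have dP : is_derive t 1 (fun t => Q t y `^ s) (s * Q t y `^ (s - 1) * (q y + 2 * t)).
    exact: (@is_derive1_comp _ (fun x : R => x `^ s) (Q ^~ y) t _ _
      (is_derive1_powR s Q0) dQ).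
  apply: is_derive_eq; rewrite /GRing.scale/=; ring.
- move=> t y te By; rewrite /K -[leLHS]add0r lerD ?mulr_ge0 ?(A0 y)//.
  apply: (le_trans (ler_normD _ _)); rewrite lerD// normrM.
    by rewrite ler_wpM2l// QP.
  rewrite ler_pM// ?aA// !normrM ler_pM// ?mulr_ge0//.
    by rewrite ler_wpM2l// QP.
  apply: (le_trans (ler_normD _ _)); rewrite lerD ?qM//.
  by rewrite normrM ger0_norm// ler_wpM2l// tN.
Qed.

End quadratic_power.

(** * The force of a uniform sphere *)

Definition usphere {R : realType} {d : nat} : set (borel_rV R d) :=
  [set x | enorm (x : 'rV[R]_d) = 1].

Lemma measurable_usphere (R : realType) (d : nat) : measurable (@usphere R d).
Proof. exact: (@measurable_enorm_set R d [set 1] (measurable_set1 1)). Qed.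

Section invariance.
Variables (R : realType) (d : nat) (sg : probability (borel_rV R d) R).
Hypothesis rad : radially_symmetric sg.
Implicit Types (f : borel_rV R d -> R) (Q : 'M[R]_d).

Let rot Q : borel_rV R d -> borel_rV R d := fun x : 'rV[R]_d => x *m Q.

Lemma integrable_rotation f Q : Q *m Q^T = 1%:M ->
  measurable_fun setT f ->
  sg.-integrable usphere (EFin \o f) ->
  sg.-integrable usphere (EFin \o f \o rot Q) /\
  \int[sg]_(y in usphere) f (rot Q y) = \int[sg]_(y in usphere) f y.
Proof.
move=> QQ mf intf.
have mQ : measurable_fun setT (rot Q) := @measurable_linear_rV R d Q.
have rotS Q' : Q' *m Q'^T = 1%:M -> rot Q' @^-1` usphere = usphere.
  by move=> QQ'; apply/seteqP; split => x; rewrite /usphere/rot/= enorm_orthogonal.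
have mS := @measurable_usphere R d.
have mfE : measurable_fun setT (EFin \o f) by exact/measurable_EFinP.
have key (Q' : 'M[R]_d) (g : borel_rV R d -> \bar R) : Q' *m Q'^T = 1%:M ->
  (\int[pushforward sg (rot Q')]_(y in usphere) g y = \int[sg]_(y in usphere) g y)%E.
  move=> QQ'.
  apply: (@eq_measure_integral _ _ _ _ sg (push_measure sg (@measurable_linear_rV R d Q'))).
  by move=> A mA _; exact: rad.
have intg : sg.-integrable usphere (EFin \o f \o rot Q).
  apply/integrableP; split.
    by apply: measurable_funTS; exact: measurableT_comp.
  have h1 : measurable_fun usphere (abse \o (EFin \o f)).
    by apply: measurable_funTS; apply: (measurableT_comp (@abse_measurable R setT)).
  have h2 : {in usphere, forall y, (0 <= (abse \o (EFin \o f)) y)%E}.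
    by move=> y _; rewrite /= lee_fin.
  have := ge0_integral_pushforward mQ sg mS h1 h2.
  rewrite rotS// key// => /esym E.
  by have /integrableP[_ h] := intf; rewrite -E in h.
split => //; rewrite /Rintegral; congr fine.
have := @integral_pushforward _ _ _ _ R (rot Q) mQ sg usphere (EFin \o f) mfE.
by rewrite rotS// key// => ->.
Qed.

End invariance.

Lemma integrable_finsum (disp : measure_display) (T : measurableType disp)
    (R : realType) (mu : {measure set T -> \bar R}) (B : set T) (I : Type) (s : seq I)
    (f : I -> T -> R) : measurable B ->
  (forall i, mu.-integrable B (EFin \o f i)) ->
  mu.-integrable B (EFin \o (fun x => \sum_(i <- s) f i x)) /\
  \int[mu]_(x in B) (\sum_(i <- s) f i x) = \sum_(i <- s) \int[mu]_(x in B) f i x.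
Proof.
move=> mB intf; elim: s => [|i s [ints IH]].
  rewrite big_nil (_ : (fun _ => _) = fun=> 0); last first.
    by apply/funext => x; rewrite big_nil.
  split; first exact: integrable0.
  by rewrite /Rintegral integral0.
have E : (fun x => \sum_(j <- i :: s) f j x) = (fun x => f i x + \sum_(j <- s) f j x).
  by apply/funext => x; rewrite big_cons.
rewrite E big_cons RintegralD// IH; split => //.
by have := integrableD mB (intf i) ints.
Qed.

Section householder.
Variables (R : realType) (d : nat).
Local Notation e0 := (delta_mx 0 ord0 : 'rV[R]_d.+1).

(** The Householder reflection in the hyperplane orthogonal to [x - e0] exchanges the unit vectors
    [e0] and [x]. *)
Lemma orthogonal_transitive (x : 'rV[R]_d.+1) : enorm x = 1 ->
  exists2 Q : 'M[R]_d.+1, Q *m Q^T = 1%:M & e0 *m Q = x.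
Proof.
move=> x1; have [->|xe] := eqVneq x e0.
  by exists 1%:M; rewrite ?trmx1 mulmx1.
pose w := x - e0; pose k := \sum_i w 0 i ^+ 2.
have kE : w *m w^T = k%:M.
  by apply/matrixP => i j; rewrite !ord1 /k sum_sqr_mul_trmx [RHS]mxE eqxx mulr1n.
have k0 : k != 0.
  by rewrite /k -sqr_enorm sqrf_eq0 enorm_eq0 subr_eq0.
(* Both vectors being of norm 1, |x - e0|^2 = 2 - 2 x_0. *)
have w0 : w 0 ord0 = - (k / 2).
  have : \sum_i x 0 i ^+ 2 = 1 by rewrite -sqr_enorm x1 expr1n.
  rewrite /k !big_ord_recl !mxE/= => h.
  have -> : \sum_(i < d) w 0 (lift ord0 i) ^+ 2 = \sum_(i < d) x 0 (lift ord0 i) ^+ 2.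
    apply: eq_bigr => i _; congr (_ ^+ 2).
    by rewrite !mxE eq_sym (negbTE (neq_lift _ _)) andbF subr0.
  have -> : \sum_(i < d) x 0 (lift ord0 i) ^+ 2 = 1 - x 0 ord0 ^+ 2 by rewrite -h; ring.
  by field.
have e0w : e0 *m w^T = (- (k / 2))%:M.
  by apply/matrixP => i j; rewrite !ord1 -rowE 2![LHS]mxE w0 [RHS]mxE eqxx mulr1n.
have NN : (w^T *m w) *m (w^T *m w) = k *: (w^T *m w).
  by rewrite mulmxA -(mulmxA _ w) kE mul_mx_scalar -scalemxAl.
have NT : (w^T *m w)^T = w^T *m w by rewrite trmx_mul trmxK.
have eN : e0 *m (w^T *m w) = - (k / 2) *: w by rewrite mulmxA e0w mul_scalar_mx.
(* Only three facts about N = w^T w remain: N N = k N, symmetry, and its action on [e0]. *)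
move: (w^T *m w) NN NT eN => N NN NT eN.
exists (1%:M - (2 / k) *: N).
  have -> : (1%:M - (2 / k) *: N)^T = 1%:M - (2 / k) *: N.
    by rewrite [LHS]linearB [in LHS]linearZ/= trmx1 NT.
  rewrite mulmxBl mul1mx mulmxBr mulmx1 -scalemxAl -scalemxAr NN !scalerA.
  rewrite (_ : 2 / k * (2 / k) * k = 2 / k + 2 / k) ?scalerDl; last by field.
  by apply/matrixP => i j; rewrite !mxE; ring.
rewrite mulmxBr mulmx1 -scalemxAr eN scalerA.
rewrite (_ : 2 / k * - (k / 2) = -1); last by field.
by rewrite scaleN1r opprK /w addrC subrK.
Qed.

End householder.

Lemma measurable_rV_subr (R : realType) (d : nat) (x : 'rV[R]_d) :
  measurable_fun setT ((fun y : 'rV[R]_d => x - y) : borel_rV R d -> borel_rV R d).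
Proof.
apply: measurable_rV => j.
apply: (eq_measurable_fun (fun y : borel_rV R d => x 0 j - (y : 'rV[R]_d) 0 j)).
  by move=> y _; rewrite !mxE.
by apply: measurable_funB => //; exact: measurable_coord.
Qed.

Section gradK_theory.
Variables (R : realType) (d : nat) (alpha : R).
Implicit Types x y : 'rV[R]_d.

Lemma gradK_orthogonal x (Q : 'M[R]_d) : Q *m Q^T = 1%:M ->
  gradK alpha (x *m Q) = gradK alpha x *m Q.
Proof. by move=> QQ; rewrite /gradK enorm_orthogonal// scalemxAl. Qed.

Lemma measurable_gradK x i : measurable_fun setT
  (fun y : borel_rV R d => gradK alpha (x - y) 0 i).
Proof.
apply: (eq_measurable_fun (fun y : borel_rV R d =>
  enorm (x - (y : 'rV[R]_d)) `^ (alpha - 2) * (x 0 i - (y : 'rV[R]_d) 0 i))).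
  by move=> y _; rewrite !mxE.
apply: measurable_funM.
  apply: (@measurableT_comp _ _ _ _ _ _ (fun t : R => t `^ (alpha - 2))).
    exact: measurable_powR.
  exact: (measurableT_comp (@measurable_enorm R d) (measurable_rV_subr x)).
by apply: measurable_funB => //; exact: measurable_coord.
Qed.

End gradK_theory.

Section radial_field.
Variables (R : realType) (d : nat) (alpha : R).
Variables (sg : probability (borel_rV R d.+1) R).
Hypothesis rad : radially_symmetric sg.
Local Notation e0 := (delta_mx 0 ord0 : 'rV[R]_d.+1).

(** The domain is [usphere], so that bounds on the distance from [x] to [y] hold at every point of
    integration. *)
Definition sphere_field (x : 'rV[R]_d.+1) (i : 'I_d.+1) : R :=
  \int[sg]_(y in usphere) gradK alpha (x - y) 0 i.

Definition sphere_field_integrable (x : 'rV[R]_d.+1) : Prop := forall i : 'I_d.+1,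
  sg.-integrable usphere (EFin \o (fun y : borel_rV R d.+1 => gradK alpha (x - y) 0 i)).

(** The orthogonal map fixing [e0] and reversing the other coordinates fixes the point, so this
    coordinate equals its opposite. *)
Lemma sphere_field_axis (rho : R) (i : 'I_d.+1) : i != ord0 ->
  sphere_field_integrable (rho *: e0) -> sphere_field (rho *: e0) i = 0.
Proof.
move=> i0 inte.
pose Q : 'M[R]_d.+1 := diag_mx (\row_j (if j == ord0 then 1 else -1)).
have QQ : Q *m Q^T = 1%:M.
  rewrite tr_diag_mx mulmx_diag -[RHS]diag_const_mx; congr diag_mx.
  by apply/rowP => j; rewrite !mxE; case: ifP; rewrite ?mulrNN mulr1.
have eQ : e0 *m Q = e0.
  apply/rowP => j; rewrite mul_mx_diag !mxE.
  by have [_|_] := eqVneq j ord0; rewrite ?mulr1// mulrN1 andbF oppr0.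
have mf := @measurable_gradK R d.+1 alpha (rho *: e0) i.
have [_ E] := integrable_rotation rad QQ mf (inte i).
have : sphere_field (rho *: e0) i = - sphere_field (rho *: e0) i.
  rewrite {1}/sphere_field -E -mulN1r /sphere_field -RintegralZl//; last first.
  - exact: measurable_usphere.
  apply: eq_Rintegral => y _.
  rewrite -{1}eQ scalemxAl -mulmxBl gradK_orthogonal// mul_mx_diag !mxE (negbTE i0).
  by rewrite mulrN1 mulN1r.
lra.
Qed.

(** Let [Q] carry [e0] to x/|x|. The field rotates as a vector, so coordinate i at [x] is the sum
    over j of [Q j i] times coordinate j on the axis; only [j = ord0] survives, with [Q ord0 i] =
    x_i/|x|. *)
Lemma sphere_field_radial (x : 'rV[R]_d.+1) : x != 0 ->
  sphere_field_integrable (enorm x *: e0) ->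
  sphere_field_integrable x /\
  forall i, sphere_field x i = sphere_field (enorm x *: e0) ord0 * (x 0 i / enorm x).
Proof.
move=> x0 inte.
have rho0 : 0 < enorm x by rewrite lt_neqAle eq_sym enorm_eq0 x0 enorm_ge0.
have [|Q QQ eQ] := @orthogonal_transitive R d ((enorm x)^-1 *: x).
  by rewrite enormZ gtr0_norm ?invr_gt0// mulVf// gt_eqF.
have xE : x = enorm x *: e0 *m Q by rewrite -scalemxAl eQ scalerA mulfV ?scale1r// gt_eqF.
have QtQ : Q^T *m Q = 1%:M by rewrite mulmx1C.
have QtQt : Q^T *m Q^T^T = 1%:M by rewrite trmxK.
pose h i j (y : borel_rV R d.+1) := Q j i * gradK alpha (enorm x *: e0 - y) 0 j.
have inth i j : sg.-integrable usphere (EFin \o h i j).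
  by have := integrableZl (@measurable_usphere R d.+1) (Q j i) (inte j).
pose g i (y : borel_rV R d.+1) := \sum_j h i j y.
have mS := @measurable_usphere R d.+1.
have [intg Eg] : (forall i, sg.-integrable usphere (EFin \o g i)) /\
    forall i, \int[sg]_(y in usphere) g i y = \sum_j \int[sg]_(y in usphere) h i j y.
  by split=> i; have [] := integrable_finsum (index_enum _) mS (inth i).
have mg i : measurable_fun setT (g i).
  apply: measurable_sum => j; apply: measurable_funM => //; exact: measurable_gradK.
have gE i (y : 'rV[R]_d.+1) : g i (y *m Q^T) = gradK alpha (x - y) 0 i.
  rewrite [X in gradK _ (X - _)]xE -[X in gradK _ (_ - X)](mulmx1 y) -QtQ.
  rewrite mulmxA -mulmxBl gradK_orthogonal// [RHS]mxE.
  by apply: eq_bigr => j _; rewrite /h mulrC.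
split=> i; have [h1 h2] := integrable_rotation rad QtQt (mg i) (intg i).
  by apply: eq_integrable h1 => // y _ /=; rewrite gE.
rewrite /sphere_field; under eq_Rintegral do rewrite -gE.
rewrite h2 Eg (bigD1 ord0)//= big1 ?addr0.
  rewrite RintegralZl// mulrC; congr (_ * _).
  have : row ord0 Q = (enorm x)^-1 *: x by rewrite rowE.
  by move=> /rowP/(_ i); rewrite !mxE => ->; rewrite mulrC.
move=> j j0; rewrite RintegralZl//.
by rewrite -/(sphere_field _ _) sphere_field_axis// mulr0.
Qed.

End radial_field.

(** * Integrability near the sphere *)

Section distance_power.
Variables (R : realType) (d : nat) (sg : probability (borel_rV R d.+1) R).
Local Notation e0 := (delta_mx 0 ord0 : 'rV[R]_d.+1).
Variable C : R.
Hypothesis C0 : 0 <= C.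
Hypothesis capC : forall eps, 0 <= eps -> (sg (polar_cap eps) <= (C * eps ^+ d)%:E)%E.

Lemma enorm_delta : enorm e0 = 1.
Proof.
rewrite /enorm (bigD1 ord0)//= big1 ?addr0; first by rewrite mxE eqxx expr1n sqrtr1.
by move=> i i0; rewrite mxE (negbTE i0) andbF expr0n.
Qed.

Lemma enorm_triangle (x y : 'rV[R]_d.+1) : enorm (x + y) <= enorm x + enorm y.
Proof.
have [->|x0] := eqVneq x 0; first by rewrite add0r lerDr enorm_ge0.
have rx : 0 < enorm x by rewrite lt_neqAle eq_sym enorm_eq0 x0 enorm_ge0.
rewrite -(@ler_pXn2r _ 2) ?nnegrE ?addr_ge0 ?enorm_ge0// sqr_enorm.
have [p pE] : exists p, p = \sum_i x 0 i * y 0 i by eexists.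
have -> : \sum_i (x + y) 0 i ^+ 2 = enorm x ^+ 2 + 2 * p + enorm y ^+ 2.
  rewrite !sqr_enorm pE mulr_sumr -!big_split/=; apply: eq_bigr => i _.
  by rewrite mxE; ring.
suff : p <= enorm x * enorm y by nra.
(* Cauchy-Schwarz, by expanding the squared norm of |x|^2 y - p x. *)
have : 0 <= \sum_i (y 0 i * enorm x ^+ 2 - p * x 0 i) ^+ 2.
  by apply: sumr_ge0 => i _; exact: sqr_ge0.
have -> : \sum_i (y 0 i * enorm x ^+ 2 - p * x 0 i) ^+ 2 =
    enorm x ^+ 2 * ((enorm x * enorm y) ^+ 2 - p ^+ 2).
  transitivity (enorm x ^+ 4 * (\sum_i y 0 i ^+ 2)
    - 2 * enorm x ^+ 2 * p * (\sum_i x 0 i * y 0 i)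
    + p ^+ 2 * (\sum_i x 0 i ^+ 2)); last by rewrite -!sqr_enorm -pE; ring.
  rewrite !mulr_sumr -sumrB -big_split/=; apply: eq_bigr => i _; ring.
rewrite pmulr_rge0 ?exprn_gt0// subr_ge0 => h.
apply: (le_trans (ler_norm p)).
by rewrite -(@ler_pXn2r _ 2) ?nnegrE ?mulr_ge0 ?enorm_ge0// real_normK ?num_real.
Qed.

Lemma measurable_distance (x : 'rV[R]_d.+1) p : measurable_fun setT
  (fun y : borel_rV R d.+1 => enorm (x - (y : 'rV[R]_d.+1)) `^ p).
Proof.
apply: (@measurableT_comp _ _ _ _ _ _ (fun t : R => t `^ p)).
  exact: measurable_powR.
exact: (measurableT_comp (@measurable_enorm R d.+1) (measurable_rV_subr x)).
Qed.

(* On the dyadic shell [2^-k < |e0 - y| <= 2^(1-k)] the integrand is at most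
   [(2^b)^k], while the shell has measure at most [C 2^((1-k)d)]. *)
Lemma integrable_negative_power (b : R) : 0 < b < d%:R ->
  sg.-integrable usphere
    (EFin \o (fun y : borel_rV R d.+1 => enorm (e0 - (y : 'rV[R]_d.+1)) `^ (- b))).
Proof.
move=> /andP[b0 bd]; have mS := @measurable_usphere R d.+1.
pose q : R := 2 `^ b.
have q0 : 0 < q by rewrite powR_gt0.
pose rad (k : nat) : R := 2 * 2 ^- k.
have rad0 k : 0 <= rad k by rewrite mulr_ge0// invr_ge0 exprn_ge0.
pose f (k : nat) (y : borel_rV R d.+1) : \bar R := ((q ^+ k)%:E * (\1_(polar_cap (rad k)) y)%:E)%E.
have f0 k y : (0 <= f k y)%E by rewrite /f mule_ge0// lee_fin// exprn_ge0 ?ltW.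
have mf k : measurable_fun usphere (f k).
  apply: measurable_funTS; apply/measurable_EFinP.
  apply: measurable_funM => //; apply: measurable_indic; exact: measurable_polar_cap.
have bnd y : usphere y -> (`|(enorm (e0 - y) `^ (- b))%:E| <= \sum_(0 <= k <oo) f k y)%E.
  move=> y1; rewrite gee0_abs ?lee_fin ?powR_ge0//.
  pose dl := enorm (e0 - y); rewrite -/dl.
  (* At the pole itself [powR] returns 0, so the singular point costs nothing. *)
  have [dl0|dl0] := eqVneq dl 0.
    by rewrite dl0 powR0 ?oppr_eq0 ?gt_eqF//; exact: nneseries_ge0.
  have dlp : 0 < dl by rewrite lt_neqAle eq_sym dl0 enorm_ge0.
  have dl2 : dl <= 2.
    by rewrite (le_trans (enorm_triangle _ _))// enormN enorm_delta y1.
  have ex : exists k : nat, 2 ^- k < dl.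
    have [k kP] : exists k : nat, dl^-1 < k%:R.
      by exists (Num.truncn dl^-1).+1; exact: truncnS_gt.
    exists k; rewrite -[ltRHS]invrK ltf_pV2 ?posrE ?invr_gt0 ?exprn_gt0//.
    by rewrite (lt_trans kP)// -natrX ltr_nat ltn_expl.
  have [k kP kmin] := find_ex_minn ex.
  apply: (@le_trans _ _ (f k y)); last first.
    apply: le_trans (nneseries_lim_ge k.+1 _); last by move=> *; exact: f0.
    by rewrite big_nat_recr//= leeDr// sume_ge0.
  have dlk : dl <= rad k.
    (* For [k = 0] there is no previous index to contradict; the diameter 2 of the sphere gives the
       bound. *)
    case: k kP kmin => [|k] kP kmin; first by rewrite /rad expr0 invr1 mulr1.
    have : dl <= 2 ^- k.
      by rewrite leNgt; apply/negP => /kmin; rewrite ltnn.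
    by move/le_trans; apply; rewrite /rad exprSr invfM mulrCA divff// mulr1.
  rewrite /f indicE mem_set/=; last first.
    by rewrite /polar_cap/= -enormN opprB.
  rewrite -EFinM mulr1 lee_fin powRN -[leRHS]invrK lef_pV2 ?posrE ?invr_gt0 ?exprn_gt0 ?powR_gt0//.
  have -> : (q ^+ k)^-1 = (2 ^- k) `^ b.
    have -> : q ^+ k = (2 ^+ k) `^ b.
      by rewrite -powR_mulrn ?(ltW q0)// /q -powRrM mulrC powRrM powR_mulrn.
    apply: (mulIf (x := (2 ^+ k) `^ b)).
      by rewrite gt_eqF// powR_gt0// exprn_gt0.
    rewrite mulVf; last by rewrite gt_eqF// powR_gt0// exprn_gt0.
    by rewrite -powRM ?invr_ge0 ?exprn_ge0// mulVf ?powR1// gt_eqF// exprn_gt0.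
  by apply: ge0_ler_powR; rewrite ?nnegrE ?invr_ge0 ?exprn_ge0 ?(ltW b0) ?(ltW kP) ?ltW.
apply/integrableP; split.
  by apply/measurable_EFinP; apply: measurable_funTS; exact: measurable_distance.
apply: (@le_lt_trans _ _ (\int[sg]_(y in usphere) (\sum_(0 <= k <oo) f k y))%E).
  apply: ge0_le_integral => //.
  - apply: measurableT_comp => //; apply/measurable_EFinP; apply: measurable_funTS.
    exact: measurable_distance.
  - by apply: ge0_emeasurable_sum => k *; [exact: f0|exact: mf].
rewrite integral_nneseries//.
(* The ratio of the series is 2^(b-d), less than 1 because [b < d]. *)
pose z : R := q / 2 ^+ d.
have z0 : 0 <= z by rewrite divr_ge0 ?exprn_ge0 ?ltW.
have z1 : z < 1.
  rewrite /z ltr_pdivrMr ?exprn_gt0// mul1r /q -powR_mulrn// /powR pnatr_eq0/=.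
  by rewrite ltr_expR ltr_pM2r// ln_gt0// ltr1n.
pose a : R := C * 2 ^+ d.
have a0 : 0 <= a by rewrite mulr_ge0// exprn_ge0.
have fle k : (\int[sg]_(y in usphere) f k y <= (geometric a z k)%:E)%E.
  rewrite /f ge0_integralZl_EFin//; last 2 first.
  - apply: measurable_funTS; apply/measurable_EFinP.
    by apply: measurable_indic; exact: measurable_polar_cap.
  - by rewrite exprn_ge0 ?ltW.
  rewrite integral_indic//; last exact: measurable_polar_cap.
  apply: (@le_trans _ _ ((q ^+ k)%:E * sg (polar_cap (rad k)))%E).
    apply: lee_wpmul2l; first by rewrite lee_fin exprn_ge0 ?ltW.
    apply: le_measure; rewrite ?inE; [|exact: measurable_polar_cap|exact: subIsetl].
    by apply: measurableI => //; exact: measurable_polar_cap.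
  apply: (@le_trans _ _ ((q ^+ k)%:E * (C * rad k ^+ d)%:E)%E).
    by apply: lee_wpmul2l; [rewrite lee_fin exprn_ge0 ?ltW|exact: capC].
  rewrite -EFinM lee_fin /geometric/= /a /z /rad le_eqVlt; apply/orP; left; apply/eqP.
  rewrite !exprMn !exprVn -!exprM (mulnC k d); field.
  by rewrite expf_neq0.
have z1' : 0 < 1 - z by rewrite subr_gt0.
apply: (@le_lt_trans _ _ (a / (1 - z))%:E); last exact: ltry.
apply: (@le_trans _ _ (\sum_(0 <= k <oo) (geometric a z k)%:E)%E).
  apply: lee_nneseries => // k _ _; apply: integral_ge0 => y _; exact: f0.
apply: lime_le.
  by apply: is_cvg_nneseries => k _ _; rewrite lee_fin mulr_ge0// exprn_ge0.
apply: nearW => k; rewrite sumEFin lee_fin.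
have := @geometric_seriesE R a z; rewrite lt_eqF// => /(_ isT) /(congr1 (fun u => u k)) /= E.
rewrite /series/= in E; rewrite E.
rewrite ler_pM2r ?invr_gt0// -[leRHS]mulr1 ler_wpM2l// gerBl exprn_ge0//.
Qed.

End distance_power.

Section distance_to_sphere.
Variables (R : realType) (d : nat).
Local Notation e0 := (delta_mx 0 ord0 : 'rV[R]_d.+1).
Implicit Types x y z : 'rV[R]_d.+1.

(** The squared norm is polynomial in the coordinates, which is the form differentiated under the
    integral. *)
Lemma enorm_powR z (p : R) : enorm z `^ p = (enorm z ^+ 2) `^ (p / 2).
Proof. by rewrite -powR_mulrn ?enorm_ge0// -powRrM mulrC divfK. Qed.

Lemma gradK_le (alpha : R) z i : `|gradK alpha z 0 i| <= enorm z `^ (alpha - 1).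
Proof.
have [z0|z0] := eqVneq (enorm z) 0.
  suff -> : gradK alpha z 0 i = 0 by rewrite normr0 powR_ge0.
  by move/eqP : z0; rewrite enorm_eq0 => /eqP ->; rewrite /gradK scaler0 mxE.
have zp : 0 < enorm z by rewrite lt_neqAle eq_sym z0 enorm_ge0.
rewrite mxE normrM ger0_norm ?powR_ge0// (_ : alpha - 1 = alpha - 2 + 1); last by ring.
rewrite [leRHS]powRD ?z0 ?implybT// powRr1 ?enorm_ge0//.
by rewrite ler_wpM2l ?powR_ge0// coord_le_enorm.
Qed.

Lemma enorm_sub_ge x y : enorm y - enorm x <= enorm (x - y).
Proof.
rewrite lerBlDr -[enorm (x - y)]enormN; apply: le_trans (enorm_triangle _ _).
by rewrite opprB subrK.
Qed.

Lemma enorm_sub_le x y : enorm (x - y) <= enorm x + enorm y.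
Proof. by rewrite -[enorm y]enormN; exact: enorm_triangle. Qed.

Lemma enorm_axis (r : R) : enorm (r *: e0) = `|r|.
Proof. by rewrite enormZ enorm_delta mulr1. Qed.

End distance_to_sphere.

(** * Integrability and differentiability of the force *)

Section field_theory.
Variables (R : realType) (d : nat) (sg : probability (borel_rV R d.+1) R).
Hypothesis rad : radially_symmetric sg.
Local Notation e0 := (delta_mx 0 ord0 : 'rV[R]_d.+1).
Local Notation S := (@usphere R d.+1).
Implicit Types x y z : 'rV[R]_d.+1.

Let mS : measurable S := @measurable_usphere R d.+1.

Lemma sphere_field_integrable_off alpha x : enorm x != 1 -> sphere_field_integrable alpha sg x.
Proof.
move=> x1 i.
pose l := `|enorm x - 1|; pose h := enorm x + 1.
apply: (@bounded_integrable _ _ R sg S mS _ (l `^ (alpha - 1) + h `^ (alpha - 1))).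
  by apply: measurable_funTS; exact: measurable_gradK.
move=> y y1; apply: (le_trans (gradK_le _ _ _)).
apply: powR_bound; first by rewrite normr_gt0 subr_eq0.
  have := enorm_sub_ge x y; have := enorm_sub_ge y x.
  rewrite -[enorm (y - x)]enormN opprB y1 /l ler_norml => h1 h2.
  by apply/andP; split; lra.
by rewrite /h -y1; exact: enorm_sub_le.
Qed.

(** For [alpha < 1] the singularity has order 1 - alpha, and the lower bound on [alpha] says that
    this is less than [d], the dimension of the sphere. *)
Lemma integrable_distance (C : R) alpha : 0 <= C ->
  (forall eps, 0 <= eps -> (sg (polar_cap eps) <= (C * eps ^+ d)%:E)%E) ->
  2 - d.+1%:R < alpha ->
  sg.-integrable S (EFin \o
    (fun y : borel_rV R d.+1 => enorm (e0 - (y : 'rV[R]_d.+1)) `^ (alpha - 1))).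
Proof.
move=> C0 capC alphad; have [a1|a1] := leP 1 alpha.
  apply: (@bounded_integrable _ _ R sg S mS _ (2 `^ (alpha - 1))) => //.
    by apply: measurable_funTS; exact: measurable_distance.
  move=> y y1; rewrite ger0_norm ?powR_ge0//.
  apply: ge0_ler_powR; rewrite ?nnegrE ?enorm_ge0 ?subr_ge0//.
  by apply: (le_trans (enorm_sub_le _ _)); rewrite enorm_delta y1.
rewrite -[alpha - 1]opprK opprB; apply: (integrable_negative_power C0 capC).
by move: alphad; rewrite -natr1 => ?; apply/andP; split; lra.
Qed.

Lemma sphere_field_integrable_axis (C : R) alpha (rho : R) : 0 <= C ->
  (forall eps, 0 <= eps -> (sg (polar_cap eps) <= (C * eps ^+ d)%:E)%E) ->
  2 - d.+1%:R < alpha -> 0 <= rho -> sphere_field_integrable alpha sg (rho *: e0).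
Proof.
move=> C0 capC alphad rho0.
have [rho1|rho1] := eqVneq rho 1; last first.
  by apply: sphere_field_integrable_off; rewrite enorm_axis ger0_norm.
move=> i; rewrite rho1 scale1r.
apply: le_integrable (integrable_distance C0 capC alphad) => //.
  apply/measurable_EFinP; apply: measurable_funTS; exact: measurable_gradK.
move=> y _ /=; rewrite lee_fin (ger0_norm (powR_ge0 _ _)); exact: gradK_le.
Qed.

(** Inside the ball the distance to the sphere stays positive, so no singularity is met. The first
    part gives a diagonal Jacobian entry of the force; the second says that the gradient of the
    average of |x - y|^alpha is [alpha] times the force. *)
Lemma is_derive_sphere_field alpha x (j : 'I_d.+1) (t0 : R) :
  enorm (x + t0 *: delta_mx 0 j) < 1 ->
  is_derive t0 1 (fun t : R => sphere_field alpha sg (x + t *: delta_mx 0 j) j)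
    (\int[sg]_(y in S) (enorm (x + t0 *: delta_mx 0 j - y) `^ (alpha - 2) +
       (alpha - 2) * ((x + t0 *: delta_mx 0 j - y) 0 j ^+ 2 *
         enorm (x + t0 *: delta_mx 0 j - y) `^ (alpha - 4)))) /\
  is_derive t0 1
    (fun t : R => \int[sg]_(y in S) (enorm (x + t *: delta_mx 0 j - y) `^ alpha))
    (alpha * sphere_field alpha sg (x + t0 *: delta_mx 0 j) j).
Proof.
set ej : 'rV[R]_d.+1 := delta_mx 0 j => x1.
pose a (y : borel_rV R d.+1) := (x - (y : 'rV[R]_d.+1)) 0 j.
pose c (y : borel_rV R d.+1) := enorm (x - (y : 'rV[R]_d.+1)) ^+ 2.
pose q (y : borel_rV R d.+1) := 2 * a y.
have QE t y : c y + q y * t + t ^+ 2 = enorm (x + t *: ej - y) ^+ 2.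
  rewrite /c !sqr_enorm (bigD1 j)//= [in RHS](bigD1 j)//= /q /a !mxE !eqxx mulr1.
  under [in RHS]eq_bigr => i ij do rewrite !mxE (negbTE ij) andbF mulr0 addr0.
  under [in LHS]eq_bigr => i ij do rewrite !mxE.
  ring.
have aE t y : a y + 1 * t = (x + t *: ej - y) 0 j.
  by rewrite /a !mxE !eqxx mulr1; ring.
(* Half the distance to the sphere: moving by less than [e] leaves a distance of at least [e]. *)
pose e := (1 - enorm (x + t0 *: ej)) / 2.
have e0 : 0 < e by rewrite /e; lra.
(* One constant for the three coefficients, which are bounded by |x| + 1, (|x| + 1)^2 and 2 (|x| +
   1). *)
pose M := 2 * (enorm x + 1) ^+ 2.
have x0 : 0 <= enorm x := enorm_ge0 x.
have aM0 y : S y -> `|a y| <= enorm x + 1.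
  by move=> y1; apply: (le_trans (coord_le_enorm _ _)); rewrite -y1; exact: enorm_sub_le.
have aM y : S y -> `|a y| <= M.
  by move=> y1; apply: (le_trans (aM0 y y1)); rewrite /M; nra.
have cM y : S y -> `|c y| <= M.
  move=> y1; rewrite ger0_norm ?sqr_ge0// /M /c.
  apply: (@le_trans _ _ ((enorm x + 1) ^+ 2)); last by rewrite ler_peMl ?sqr_ge0//; lra.
  by rewrite ler_pXn2r ?nnegrE ?enorm_ge0 ?addr_ge0// -y1; exact: enorm_sub_le.
have qM y : S y -> `|q y| <= M.
  move=> y1; rewrite /q normrM ger0_norm// /M ler_pM2l//.
  by apply: (le_trans (aM0 y y1)); nra.
have ma : measurable_fun S a.
  apply: measurable_funTS; apply: (eq_measurable_fun
    (fun y : borel_rV R d.+1 => x 0 j - (y : 'rV[R]_d.+1) 0 j)) => [y _|].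
    by rewrite /a !mxE.
  by apply: measurable_funB => //; exact: measurable_coord.
have mc : measurable_fun S c.
  apply: measurable_funTS.
  apply: (eq_measurable_fun (fun y : borel_rV R d.+1 => enorm (x - (y : 'rV[R]_d.+1)) `^ 2)).
    by move=> y _; rewrite powR_mulrn// enorm_ge0.
  exact: measurable_distance.
have mq : measurable_fun S q by apply: measurable_funM.
have Qd t y : `|t - t0| < e -> S y -> e ^+ 2 <= c y + q y * t + t ^+ 2.
  move=> te y1; rewrite QE ler_pXn2r ?nnegrE ?enorm_ge0 ?(ltW e0)//.
  have h1 := enorm_sub_ge (x + t *: ej) y.
  have : enorm (x + t *: ej) <= enorm (x + t0 *: ej) + e.
    have -> : x + t *: ej = (x + t0 *: ej) + (t - t0) *: ej.
      by apply/rowP => i; rewrite !mxE; ring.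
    apply: (le_trans (enorm_triangle _ _)); rewrite lerD2l enormZ.
    have -> : enorm ej = 1.
      rewrite /enorm (bigD1 j)//= big1 ?addr0; first by rewrite mxE !eqxx expr1n sqrtr1.
      by move=> i ij; rewrite mxE (negbTE ij) andbF expr0n.
    by rewrite mulr1 ltW.
  by move: h1; rewrite y1 /e; lra.
have e20 : 0 < e ^+ 2 by rewrite exprn_gt0.
split.
  have := is_derive_integral_quadratic_power sg mS 1 ((alpha - 2) / 2) e0 e20 ma mc mq aM cM qM Qd.
  rewrite (_ : (fun t => \int[sg]_(y in S) _) =
    (fun t : R => sphere_field alpha sg (x + t *: ej) j)); last first.
    apply/funext => t; apply: eq_Rintegral => y _.
    by rewrite aE QE -enorm_powR [RHS]mxE mulrC.
  move=> /is_derive_eq; apply; apply: eq_Rintegral => y _.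
  rewrite mul1r aE QE -enorm_powR; congr (_ + _).
  rewrite (_ : q y + 2 * t0 = 2 * (a y + 1 * t0)); last by rewrite /q; ring.
  rewrite aE (_ : (alpha - 2) / 2 - 1 = (alpha - 4) / 2); last by field.
  by rewrite -enorm_powR; field.
pose one (y : borel_rV R d.+1) : R := 1.
have M1 : 1 <= M.
  have -> : M = 2 * enorm x ^+ 2 + 4 * enorm x + 2 by rewrite /M; ring.
  have := sqr_ge0 (enorm x); lra.
have oneM y : S y -> `|one y| <= M by rewrite normr1.
have := is_derive_integral_quadratic_power sg mS 0 (alpha / 2) e0 e20
  (measurable_cst _) mc mq oneM cM qM Qd.
rewrite (_ : (fun t => \int[sg]_(y in S) _) = (fun t : R =>
   \int[sg]_(y in S) (enorm (x + t *: ej - y) `^ alpha))); last first.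
  apply/funext => t; apply: eq_Rintegral => y _.
  by rewrite QE -enorm_powR /one mul0r addr0 mul1r.
move=> /is_derive_eq; apply; rewrite /sphere_field -RintegralZl//; last first.
  by apply: sphere_field_integrable_off; rewrite lt_eqF.
apply: eq_Rintegral => y _.
rewrite QE !mul0r add0r addr0 mul1r.
rewrite (_ : q y + 2 * t0 = 2 * (a y + 1 * t0)); last by rewrite /q; ring.
rewrite aE (_ : alpha / 2 - 1 = (alpha - 2) / 2); last by field.
by rewrite -enorm_powR [X in _ = _ * X]mxE; field.
Qed.

End field_theory.

(** * The radial force as a function of the radius *)

(** Derivability on the closed interval supplies continuity; the formula is asked only inside, since
    the divergence identity divides by the radius and says nothing at 0. *)
Lemma lt_of_derive_gt0 (R : realType) (f f' : R -> R) (a b : R) : a < b ->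
  (forall x, a <= x <= b -> derivable f x 1) ->
  (forall x, a < x < b -> is_derive x 1 f (f' x)) ->
  (forall x, a < x < b -> 0 < f' x) -> f a < f b.
Proof.
move=> ab df dff' f'0.
have dI x : x \in `]a, b[ -> is_derive x 1 f (f' x) by rewrite in_itv; exact: dff'.
have cI : {within `[a, b], continuous f}.
  by apply: derivable_within_continuous => x; rewrite in_itv; exact: df.
have [c + E] := MVT ab dI cI.
by rewrite in_itv => cab; rewrite -subr_gt0 E mulr_gt0 ?subr_gt0// f'0.
Qed.

Section ode.
Variables (R : realType) (d : nat) (sg : probability (borel_rV R d.+1) R).
Hypothesis rad : radially_symmetric sg.
Hypothesis sph : sg (@usphere R d.+1) = 1%E.
Local Notation e0 := (delta_mx 0 ord0 : 'rV[R]_d.+1).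
Local Notation S := (@usphere R d.+1).

Let mS : measurable S := @measurable_usphere R d.+1.

Definition radial_force (alpha r : R) : R := sphere_field alpha sg (r *: e0) ord0.

(** The overview's W is the case of exponent [alpha - 2]. *)
Definition sphere_potential (alpha r : R) : R :=
  \int[sg]_(y in S) (enorm (r *: e0 - (y : 'rV[R]_d.+1)) `^ alpha).

(** The partial derivative of the j-th coordinate of [gradK] along the j-th axis, at
    [r *: e0 - y]. *)
Definition dgradK (alpha r : R) (j : 'I_d.+1) (y : borel_rV R d.+1) : R :=
  enorm (r *: e0 - (y : 'rV[R]_d.+1)) `^ (alpha - 2) +
  (alpha - 2) * ((r *: e0 - (y : 'rV[R]_d.+1)) 0 j ^+ 2 *
     enorm (r *: e0 - (y : 'rV[R]_d.+1)) `^ (alpha - 4)).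

Lemma radial_force_derive (alpha r : R) : `|r| < 1 ->
  is_derive r 1 (radial_force alpha) (\int[sg]_(y in S) dgradK alpha r ord0 y).
Proof.
move=> r1; have := @is_derive_sphere_field R d sg alpha 0 ord0 r.
rewrite add0r enorm_axis => /(_ r1)[H _].
rewrite /radial_force; under eq_fun do rewrite -[_ *: _]add0r.
exact: H.
Qed.

Lemma sphere_potential_derive (alpha r : R) : `|r| < 1 ->
  is_derive r 1 (sphere_potential alpha) (alpha * radial_force alpha r).
Proof.
move=> r1; have := @is_derive_sphere_field R d sg alpha 0 ord0 r.
rewrite add0r enorm_axis => /(_ r1)[_ H].
have E : (fun t : R => \int[sg]_(y in S)
    (enorm (0 + t *: e0 - (y : 'rV[R]_d.+1)) `^ alpha)) = sphere_potential alpha.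
  by apply/funext => t; rewrite /sphere_potential add0r.
by rewrite E in H.
Qed.

Lemma radial_force_continuous (alpha r : R) : `|r| < 1 -> {for r, continuous (radial_force alpha)}.
Proof.
by move=> /radial_force_derive-/(_ alpha)[+ _] => /derivable1_diffP/differentiable_continuous.
Qed.

(* At [r *: e0 + t *: e_j] the force is radial, so its j-th coordinate is
   [radial_force rho * (t / rho)] with [rho ^ 2 = r ^ 2 + t ^ 2]. *)
Lemma transverse_derivative (alpha r : R) (j : 'I_d.+1) : 0 < r < 1 -> j != ord0 ->
  \int[sg]_(y in S) dgradK alpha r j y = radial_force alpha r / r.
Proof.
move=> /andP[r0 r1] j0.
have H : is_derive (0 : R) 1
    (fun t : R => sphere_field alpha sg (r *: e0 + t *: delta_mx 0 j) j)
    (\int[sg]_(y in S) dgradK alpha r j y).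
  have := @is_derive_sphere_field R d sg alpha (r *: e0) j 0.
  by rewrite scale0r addr0 enorm_axis ger0_norm ?ltW// => /(_ r1)[].
pose rho (t : R) := Num.sqrt (r ^+ 2 + t ^+ 2).
have rhoE t : enorm (r *: e0 + t *: delta_mx 0 j) = rho t.
  rewrite /enorm (bigD1 ord0)//= (bigD1 j)//= big1 ?addr0.
    rewrite !mxE !eqxx/= [_ == j]eq_sym (negbTE j0) mulr0 addr0 mulr1 mulr0 add0r.
    by rewrite mulr1.
  by move=> i /andP[i0 ij]; rewrite !mxE (negbTE i0) (negbTE ij) !mulr0 addr0 expr0n.
have rho0 t : 0 < rho t.
  by rewrite sqrtr_gt0 ltr_pwDl ?exprn_gt0// sqr_ge0.
have xt0 t : r *: e0 + t *: delta_mx 0 j != 0.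
  by rewrite -enorm_eq0 rhoE gt_eqF.
have fieldE t : rho t < 1 ->
    sphere_field alpha sg (r *: e0 + t *: delta_mx 0 j) j =
    radial_force alpha (rho t) * (t / rho t).
  move=> rt1; have [|_ ->] := @sphere_field_radial R d alpha sg rad _ (xt0 t).
    by apply: sphere_field_integrable_off; rewrite enorm_axis rhoE gtr0_norm// lt_eqF.
  rewrite rhoE; congr (_ * (_ / _)).
  by rewrite !mxE !eqxx (negbTE j0)/= mulr0 add0r mulr1.
have rho_cvg : rho t @[t --> 0^'] --> r.
  have -> : r = rho 0 by rewrite /rho expr0n addr0 sqrtr_sqr ger0_norm ?ltW.
  apply: cvg_within_filter; apply: (continuous_comp (f := fun t : R => r ^+ 2 + t ^+ 2)).
    by apply: cvgD; [exact: cvg_cst|exact: exprn_continuous].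
  exact: sqrt_continuous.
have lim1 : radial_force alpha (rho t) / rho t @[t --> 0^'] --> radial_force alpha r / r.
  apply: cvgM.
    apply: cvg_comp rho_cvg _; apply: radial_force_continuous; by rewrite gtr0_norm.
  by apply: cvgV => //; rewrite gt_eqF.
have [dH vH] := H.
have lim2 : radial_force alpha (rho t) / rho t @[t --> 0^'] -->
    \int[sg]_(y in S) dgradK alpha r j y.
  rewrite -vH; apply: cvg_trans dH; apply: near_eq_cvg.
  have rl : \forall t \near (0 : R)^', rho t < 1.
    exact: (@cvgr_lt R _ _ _ rho r rho_cvg 1 r1).
  near=> t; have t0 : t != 0 by near: t; exact: nbhs_dnbhs_neq.
  have rt1 : rho t < 1 by near: t.
  rewrite /= scaler1 addr0 !fieldE//; last first.
    by rewrite /rho expr0n addr0 sqrtr_sqr gtr0_norm.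
  by rewrite mul0r mulr0 subr0 /GRing.scale/= mulrCA (mulrA t^-1) mulVf// mul1r.
exact: (cvg_unique _ lim2 lim1).
Unshelve. all: by end_near. Qed.

Lemma enorm_axis_bounds (r : R) (y : borel_rV R d.+1) : `|r| < 1 -> S y ->
  1 - `|r| <= enorm (r *: e0 - (y : 'rV[R]_d.+1)) <= 2.
Proof.
move=> r1 y1; have := enorm_sub_ge (r *: e0) y; have := enorm_sub_le (r *: e0) y.
by rewrite y1 enorm_axis => h1 h2; apply/andP; split; lra.
Qed.

Lemma measurable_dgradK (alpha r : R) (j : 'I_d.+1) :
  measurable_fun setT (dgradK alpha r j).
Proof.
apply: measurable_funD; first exact: measurable_distance.
apply: measurable_funM => //; apply: measurable_funM; last exact: measurable_distance.
apply: measurable_funX.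
apply: (eq_measurable_fun
  (fun y : borel_rV R d.+1 => (r *: e0) 0 j - (y : 'rV[R]_d.+1) 0 j)) => [y _|].
  by rewrite !mxE.
by apply: measurable_funB => //; exact: measurable_coord.
Qed.

Lemma distance_axis_bound (p r : R) (y : borel_rV R d.+1) : `|r| < 1 -> S y ->
  `|enorm (r *: e0 - (y : 'rV[R]_d.+1)) `^ p| <= (1 - `|r|) `^ p + 2 `^ p.
Proof.
move=> r1 y1; rewrite ger0_norm ?powR_ge0//.
have /andP[h1 h2] := enorm_axis_bounds r1 y1.
by apply: powR_bound => //; rewrite subr_gt0.
Qed.

Lemma integrable_dgradK (alpha r : R) (j : 'I_d.+1) : `|r| < 1 ->
  sg.-integrable S (EFin \o dgradK alpha r j).
Proof.
move=> r1; pose K p := (1 - `|r|) `^ p + 2 `^ p.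
apply: (@bounded_integrable _ _ R sg S mS _
    (K (alpha - 2) + `|alpha - 2| * (4 * K (alpha - 4)))).
  by apply: measurable_funTS; exact: measurable_dgradK.
move=> y y1; rewrite /dgradK (le_trans (ler_normD _ _))// lerD//.
  exact: distance_axis_bound.
rewrite normrM ler_wpM2l// normrM ler_pM//; last exact: distance_axis_bound.
have /andP[_ h2] := enorm_axis_bounds r1 y1.
rewrite normrX (_ : 4 = 2 ^+ 2) ?ler_pXn2r ?nnegrE//; last by ring.
exact: le_trans (coord_le_enorm _ _) h2.
Qed.

(** Trace of the Jacobian: the squared coordinates add up to |z|^2, which turns |z|^(alpha-4) into
    |z|^(alpha-2). *)
Lemma sum_dgradK (alpha r : R) : `|r| < 1 ->
  \sum_j \int[sg]_(y in S) dgradK alpha r j y =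
  (alpha - 2 + d.+1%:R) * sphere_potential (alpha - 2) r.
Proof.
move=> r1.
have [_ <-] := integrable_finsum (index_enum _) mS (fun j => integrable_dgradK alpha j r1).
rewrite /sphere_potential -RintegralZl//; last first.
  apply: (@bounded_integrable _ _ R sg S mS _ ((1 - `|r|) `^ (alpha - 2) + 2 `^ (alpha - 2))).
    by apply: measurable_funTS; exact: measurable_distance.
  by move=> y y1; exact: distance_axis_bound.
apply: eq_Rintegral => y /set_mem y1.
rewrite /dgradK big_split/= -mulr_sumr -mulr_suml -sqr_enorm sumr_const card_ord.
have /andP[e1 _] := enorm_axis_bounds r1 y1.
have en0 : 0 < enorm (r *: e0 - (y : 'rV[R]_d.+1)).
  by apply: lt_le_trans e1; rewrite subr_gt0.
rewrite -powR_mulrn ?enorm_ge0// -powRD; last by rewrite (gt_eqF en0) implybT.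
rewrite (_ : 2 + (alpha - 4) = alpha - 2); last by ring.
by rewrite -mulr_natl; ring.
Qed.

(** In the trace the axis contributes Phi' and each of the [d] transverse directions Phi/r. On the
    line, [d = 0], there is no transverse direction and the formula persists. *)
Lemma radial_force_ode (alpha r : R) : 0 < r < 1 ->
  is_derive r 1 (radial_force alpha)
    ((alpha - 2 + d.+1%:R) * sphere_potential (alpha - 2) r - d%:R * radial_force alpha r / r).
Proof.
move=> /[dup] rr /andP[r0 r1]; have ar : `|r| < 1 by rewrite gtr0_norm.
apply: (is_derive_eq (radial_force_derive alpha ar)).
rewrite -sum_dgradK// big_ord_recl (eq_bigr (fun=> radial_force alpha r / r)).
  rewrite sumr_const card_ord -[X in _ + X - _]mulr_natl; ring.
by move=> j _; rewrite transverse_derivative.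
Qed.

Lemma sphere_potential_gt0 (alpha r : R) : `|r| < 1 -> 0 < sphere_potential alpha r.
Proof.
move=> r1.
(* A lower bound for a power is the inverse of an upper bound for the opposite power. *)
pose K := (1 - `|r|) `^ (- alpha) + 2 `^ (- alpha).
have K0 : 0 < K by rewrite ltr_wpDr ?powR_ge0// powR_gt0// subr_gt0.
have bd y : S y -> K^-1 <= enorm (r *: e0 - (y : 'rV[R]_d.+1)) `^ alpha.
  move=> y1; have /andP[h1 h2] := enorm_axis_bounds r1 y1.
  have l0 : 0 < 1 - `|r| by rewrite subr_gt0.
  rewrite -[alpha]opprK powRN lef_pV2 ?posrE// ?powR_bound// powR_gt0//.
  exact: lt_le_trans l0 h1.
have l0 : 0 < 1 - `|r| by rewrite subr_gt0.
apply: (@lt_le_trans _ _ (\int[sg]_(y in S) K^-1)).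
  by rewrite Rintegral_cst// [X in fine X]sph/= mulr1 invr_gt0.
apply: le_Rintegral => //.
- by apply: (@bounded_integrable _ _ R sg S mS _ `|K^-1|).
- apply: (@bounded_integrable _ _ R sg S mS _ ((1 - `|r|) `^ alpha + 2 `^ alpha)).
    by apply: measurable_funTS; exact: measurable_distance.
  by move=> y y1; exact: distance_axis_bound.
Qed.

End ode.

(** * Monotonicity of force and potential inside the sphere *)

Section monotonicity.
Variables (R : realType) (d : nat) (sg : probability (borel_rV R d.+1) R).
Hypothesis rad : radially_symmetric sg.
Hypothesis sph : sg (@usphere R d.+1) = 1%E.
Local Notation e0 := (delta_mx 0 ord0 : 'rV[R]_d.+1).
Local Notation S := (@usphere R d.+1).
Local Notation Phi := (radial_force sg).
Local Notation W := (sphere_potential sg).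
Local Notation D := (d.+1%:R : R).

Let mS : measurable S := @measurable_usphere R d.+1.

Lemma gradK_opp (n : nat) (alpha : R) (z : 'rV[R]_n) : gradK alpha (- z) = - gradK alpha z.
Proof. by rewrite /gradK enormN scalerN. Qed.

(** [-1] is orthogonal, so the force at the centre equals its opposite. *)
Lemma radial_force_0 (alpha : R) : Phi alpha 0 = 0.
Proof.
have QQ : (- 1%:M : 'M[R]_d.+1) *m (- 1%:M)^T = 1%:M.
  by rewrite linearN/= trmx1 mulNmx mulmxN opprK mulmx1.
have int0 : sphere_field_integrable alpha sg (0 *: e0).
  by apply: sphere_field_integrable_off; rewrite enorm_axis normr0 eq_sym oner_eq0.
have mf := @measurable_gradK R d.+1 alpha (0 *: e0) ord0.
have [_ E] := integrable_rotation rad QQ mf (int0 ord0).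
have : Phi alpha 0 = - Phi alpha 0.
  transitivity (\int[sg]_(y in S) (-1 * gradK alpha (0 *: e0 - (y : 'rV[R]_d.+1)) 0 ord0)).
    rewrite /radial_force /sphere_field -E; apply: eq_Rintegral => y _.
    by rewrite mulmxN mulmx1 scale0r !sub0r gradK_opp mulN1r [LHS]mxE.
  by rewrite RintegralZl ?mulN1r.
lra.
Qed.

Lemma sphere_potential_0 (alpha : R) : W alpha 0 = 1.
Proof.
transitivity (\int[sg]_(y in S) (1 : R)).
  apply: eq_Rintegral => y /set_mem y1.
  by rewrite scale0r sub0r enormN y1 powR1.
by rewrite Rintegral_cst// [X in fine X]sph/= mulr1.
Qed.

Lemma scaled_radial_force_derivable (alpha r : R) : `|r| < 1 ->
  derivable (fun t : R => t ^+ d * Phi alpha t) r 1.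
Proof.
move=> r1; have [dP _] := radial_force_derive sg alpha r1.
by apply: derivableM; [exact: exprn_derivable|exact: dP].
Qed.

(** r^d is the integrating factor of Phi' + d Phi/r. *)
Lemma scaled_radial_force_derive (alpha r : R) : 0 < r < 1 ->
  is_derive r 1 (fun t : R => t ^+ d * Phi alpha t)
    ((alpha - 2 + D) * (r ^+ d * W (alpha - 2) r)).
Proof.
move=> rr; have H := radial_force_ode rad alpha rr.
have r0 : r != 0 by case/andP: rr => r0 _; rewrite gt_eqF.
have HX : is_derive r 1 (fun t : R => t ^+ d) (d%:R * r ^+ d.-1).
  by apply: DeriveDef; [exact: exprn_derivable|rewrite exp_derive /GRing.scale/= mulr1].
apply: (is_derive_eq (is_deriveM HX H)); rewrite /GRing.scale/=.
move: (Phi alpha r) (W (alpha - 2) r) => p w.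
(* [d.-1] is truncated at [d = 0], which is treated apart. *)
case: (d) => [|n]; first by rewrite !expr0; field.
by rewrite -pred_Sn exprS; field.
Qed.

(** The product r^d Phi decreases from 0. The intended exponent is [alpha - 2], for which the
    hypothesis reads alpha - 4 + D < 0. *)
Lemma radial_force_lt0 (alpha r : R) : alpha - 2 + D < 0 -> 0 < r < 1 -> Phi alpha r < 0.
Proof.
move=> aD /[dup] rr /andP[r0 r1].
pose f (t : R) := - (t ^+ d * Phi alpha t).
pose f' (t : R) := - ((alpha - 2 + D) * (t ^+ d * W (alpha - 2) t)).
have : f 0 < f r.
  apply: (@lt_of_derive_gt0 R f f') => //.
  - move=> x /andP[x0 xr]; apply: derivableN; apply: scaled_radial_force_derivable.
    by rewrite ger0_norm//; lra.
  - move=> x /andP[x0 xr].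
    have := @scaled_radial_force_derive alpha x; rewrite x0 (lt_trans xr r1) => /(_ isT) H.
    exact: is_deriveN.
  - move=> x /andP[x0 xr]; rewrite /f' -mulNr mulr_gt0 ?oppr_gt0// mulr_gt0 ?exprn_gt0//.
    by apply: sphere_potential_gt0; rewrite // gtr0_norm//; lra.
rewrite /f radial_force_0 mulr0 oppr0 oppr_gt0 pmulr_rlt0// exprn_gt0//.
Qed.

(** The derivative is a product of two negative factors, [alpha - 2] and the force of exponent
    [alpha - 2]. *)
Lemma sphere_potential_gt1 (alpha r : R) : alpha < 2 -> alpha - 4 + D < 0 -> 0 < r < 1 ->
  1 < W (alpha - 2) r.
Proof.
move=> a2 aD /andP[r0 r1]; rewrite -[ltLHS](sphere_potential_0 (alpha - 2)).
apply: (@lt_of_derive_gt0 R (W (alpha - 2)) (fun t => (alpha - 2) * Phi (alpha - 2) t)).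
- exact: r0.
- move=> x /andP[x0 xr]; have x1 : `|x| < 1 by rewrite ger0_norm//; lra.
  by have [] := sphere_potential_derive sg (alpha - 2) x1.
- move=> x /andP[x0 xr]; apply: sphere_potential_derive; rewrite gtr0_norm//; lra.
- move=> x /andP[x0 xr]; rewrite nmulr_rgt0 ?subr_lt0//; apply: radial_force_lt0; first lra.
  by rewrite x0; lra.
Qed.

(** The subtracted term is what t^d Phi would be for W constantly 1, so the derivative is (alpha - 2
    + D) t^d (W - 1). *)
Lemma radial_force_excess_incr (alpha a b : R) :
  alpha < 2 -> alpha - 4 + D < 0 -> 0 < alpha - 2 + D -> 0 <= a -> a < b -> b < 1 ->
  a ^+ d * Phi alpha a - (alpha - 2 + D) / D * a ^+ d.+1 <
  b ^+ d * Phi alpha b - (alpha - 2 + D) / D * b ^+ d.+1.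
Proof.
move=> a2 aD4 aD2 a0 ab b1.
pose f (t : R) := t ^+ d * Phi alpha t - (alpha - 2 + D) / D * t ^+ d.+1.
pose f' (t : R) := (alpha - 2 + D) * (t ^+ d * W (alpha - 2) t) - (alpha - 2 + D) * t ^+ d.
apply: (@lt_of_derive_gt0 R f f') => //.
- move=> x /andP[x0 xr]; apply: derivableB.
    by apply: scaled_radial_force_derivable; rewrite ger0_norm//; lra.
  by apply: derivableM => //; exact: exprn_derivable.
- move=> x /andP[x0 xr].
  have := @scaled_radial_force_derive alpha x.
  rewrite (le_lt_trans a0 x0) (lt_trans xr b1) => /(_ isT) H.
  have D0 : D != 0 by rewrite pnatr_eq0.
  have HX : is_derive x 1 (fun t : R => t ^+ d.+1) (D * x ^+ d).
    by apply: DeriveDef; [exact: exprn_derivable|rewrite exp_derive /GRing.scale/= mulr1].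
  apply: (is_derive_eq (is_deriveB H (is_deriveZ ((alpha - 2 + D) / D) HX))).
  by rewrite /f' /GRing.scale/=; congr (_ - _); field.
- move=> x /andP[x0 xr]; rewrite /f' -mulrBr mulr_gt0// subr_gt0.
  have x00 : 0 < x := le_lt_trans a0 x0.
  rewrite -[ltLHS]mulr1 ltr_pM2l ?exprn_gt0//; apply: sphere_potential_gt1 => //.
  by rewrite x00 (lt_trans xr).
Qed.

(** At the centre, permuting coordinates shows that the [D] diagonal Jacobian entries are equal, so
    each is the trace divided by [D]. *)
Lemma radial_force_derive_0 (alpha : R) :
  is_derive (0 : R) 1 (Phi alpha) ((alpha - 2 + D) / D).
Proof.
have n01 : `|0 : R| < 1 by rewrite normr0.
have H := radial_force_derive sg alpha n01; apply: (is_derive_eq H).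
have := sum_dgradK sg alpha n01; rewrite sphere_potential_0 mulr1 => <-.
rewrite (eq_bigr (fun=> \int[sg]_(y in S) dgradK alpha 0 ord0 y)).
  by rewrite sumr_const card_ord -[X in _ = X / _]mulr_natr mulfK// pnatr_eq0.
move=> j _.
pose s := perm.tperm ord0 j.
have QQ : (perm_mx s : 'M[R]_d.+1) *m (perm_mx s)^T = 1%:M.
  by rewrite tr_perm_mx perm.tpermV -perm_mxM perm.tperm2 perm_mx1.
have [_ <-] := integrable_rotation rad QQ (measurable_dgradK alpha 0 ord0)
  (integrable_dgradK sg alpha ord0 n01).
apply: eq_Rintegral => y /set_mem y1; rewrite /dgradK !scale0r !sub0r !enormN.
rewrite (enorm_orthogonal _ QQ); congr (_ + _ * (_ * _)).
have -> : (y : 'rV[R]_d.+1) *m perm_mx s = col_perm s y by rewrite col_permE perm.tpermV.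
by rewrite !mxE perm.tpermL.
Qed.

End monotonicity.

(** * The force ratio at 1, near 0 and at infinity *)

Section limits.
Variables (R : realType) (d : nat) (sg : probability (borel_rV R d.+1) R).
Hypothesis rad : radially_symmetric sg.
Hypothesis sph : sg (@usphere R d.+1) = 1%E.
Variable C : R.
Hypothesis C0 : 0 <= C.
Hypothesis capC : forall eps, 0 <= eps -> (sg (polar_cap eps) <= (C * eps ^+ d)%:E)%E.
Local Notation e0 := (delta_mx 0 ord0 : 'rV[R]_d.+1).
Local Notation S := (@usphere R d.+1).
Local Notation Phi := (radial_force sg).
Local Notation D := (d.+1%:R : R).

Variable alpha : R.
Hypotheses (alpha2 : alpha < 2) (alphaD2 : 2 - D < alpha) (alphaD4 : alpha < 4 - D).

Let mS : measurable S := @measurable_usphere R d.+1.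

Lemma enorm_sub_cvg (u : nat -> 'rV[R]_d.+1) (x y : 'rV[R]_d.+1) :
  enorm (u n - x) @[n --> \oo] --> 0 ->
  enorm (u n - y) @[n --> \oo] --> enorm (x - y).
Proof.
move=> ux; apply/cvgrPdist_le => e e_gt0.
near=> n; apply: (@le_trans _ _ (enorm (u n - x))).
  have h1 := enorm_triangle (u n - x) (x - y).
  have h2 := enorm_triangle (x - u n) (u n - y).
  rewrite -[enorm (x - u n)]enormN opprB in h2.
  have e1 : u n - x + (x - y) = u n - y by rewrite addrA subrK.
  have e2 : x - u n + (u n - y) = x - y by rewrite addrA subrK.
  by rewrite e1 in h1; rewrite e2 in h2; rewrite ler_norml; apply/andP; split; lra.
rewrite -[leLHS]ger0_norm ?enorm_ge0//.
by near: n; move/cvgr0_norm_le : ux; apply.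
Unshelve. all: by end_near. Qed.

(* As [alpha] may be less than 1, the integrand at radius [r < 1] can blow up at [e0]
   when [r] tends to 1; it is nonpositive at [e0] while the limit integrand vanishes
   there, so [e0] is cut out by an indicator function before passing to the limit. *)
Lemma radial_force_1_gt : (alpha - 2 + D) / D < Phi alpha 1.
Proof.
pose r (n : nat) : R := 1 - harmonic n / 2.
have har n : 0 < (harmonic n : R) <= 1.
  by rewrite harmonic_gt0/= invf_le1 ?ltr0n// ler1n.
have r12 n : 1 / 2 <= r n < 1.
  by have /andP[h0 h1] := har n; rewrite /r; apply/andP; split; lra.
have rcvg : r n @[n --> \oo] --> (1 : R).
  rewrite -[X in _ --> X]subr0; apply: cvgB; first exact: cvg_cst.
  rewrite -[X in _ --> X](mul0r 2^-1); apply: cvgMl; exact: cvg_harmonic.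
pose A : set (borel_rV R d.+1) := ~` (polar_cap 0).
have mA : measurable A by apply: measurableC; exact: measurable_polar_cap.
have Ae0 (y : 'rV[R]_d.+1) : ~ A y -> y = e0.
  move=> /contrapT; rewrite /polar_cap/= => h; apply/eqP.
  by rewrite -subr_eq0 -enorm_eq0 eq_le h enorm_ge0.
have A0 (y : 'rV[R]_d.+1) : A y -> 0 < enorm (e0 - y).
  rewrite /A/polar_cap/= => h; rewrite -enormN opprB ltNge; exact/negP.
pose f (n : nat) (y : borel_rV R d.+1) : R :=
  gradK alpha (r n *: e0 - (y : 'rV[R]_d.+1)) 0 ord0 * \1_A y.
pose g (y : borel_rV R d.+1) : R :=
  gradK alpha (e0 - (y : 'rV[R]_d.+1)) 0 ord0 * \1_A y.
(* Both |e0 - y| <= (1 - r) + |r e0 - y| and 1 - r <= |r e0 - y| hold, whence |r e0 - y| >= |e0 -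
   y|/2, uniformly in r < 1. *)
pose G (y : borel_rV R d.+1) : R :=
  2^-1 `^ (alpha - 1) * enorm (e0 - (y : 'rV[R]_d.+1)) `^ (alpha - 1) + 2 `^ (alpha - 1).
have mf n : measurable_fun S (EFin \o f n).
  apply/measurable_EFinP; apply: measurable_funTS; apply: measurable_funM.
    exact: measurable_gradK.
  exact: measurable_indic.
have mg : measurable_fun S (EFin \o g).
  apply/measurable_EFinP; apply: measurable_funTS; apply: measurable_funM.
    exact: measurable_gradK.
  exact: measurable_indic.
have intG : sg.-integrable S (EFin \o G).
  have i1 := integrableZl mS (2^-1 `^ (alpha - 1)) (integrable_distance C0 capC alphaD2).
  have i2 : sg.-integrable S (EFin \o (fun=> 2 `^ (alpha - 1))).
    exact: (@bounded_integrable _ _ R sg S mS _ `|2 `^ (alpha - 1)|).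
  exact: (integrableD mS i1 i2).
have rE n : enorm (r n *: e0 - e0) = `|r n - 1|.
  by rewrite -(@enorm_axis R d) [in RHS]scalerBl scale1r.
have fG n y : S y -> `|f n y| <= G y.
  move=> y1; rewrite /f indicE; have [Ay|Ay] := pselect (A y); last first.
    by rewrite memNset//= mulr0 normr0 addr_ge0 ?mulr_ge0 ?powR_ge0.
  rewrite mem_set// mulr1; apply: (le_trans (gradK_le _ _ _)).
  have /andP[rn1 rn2] := r12 n.
  have rn0 : 0 <= r n by lra.
  rewrite /G -powRM ?invr_ge0 ?enorm_ge0//; apply: powR_bound.
  - by rewrite mulr_gt0 ?invr_gt0// A0.
  - have := enorm_triangle (e0 - r n *: e0) (r n *: e0 - y).
    rewrite addrA subrK -[enorm (e0 - r n *: e0)]enormN opprB rE => h1.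
    have := enorm_sub_ge (r n *: e0) y; rewrite y1 enorm_axis ger0_norm// => h2.
    by move: h1; rewrite distrC ger0_norm ?subr_ge0 ?(ltW rn2)// => h1; lra.
  - by apply: (le_trans (enorm_sub_le _ _)); rewrite enorm_axis y1 ger0_norm//; lra.
have fg y : S y -> f n y @[n --> \oo] --> g y.
  move=> y1; rewrite /f /g indicE; have [Ay|Ay] := pselect (A y); last first.
    by rewrite memNset// mulr0; under eq_fun do rewrite mulr0; exact: cvg_cst.
  rewrite mem_set// mulr1; under eq_fun do rewrite mulr1 mxE; rewrite mxE.
  apply: cvgM.
    have en_cvg : enorm (r n *: e0 - y) @[n --> \oo] --> enorm (e0 - y).
      apply: enorm_sub_cvg; under eq_fun do rewrite rE.
      rewrite -(normr0 R); apply: cvg_norm; rewrite -(subrr 1); apply: cvgB => //.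
      exact: cvg_cst.
    have [dp _] := is_derive1_powR (alpha - 2) (A0 _ Ay).
    have cP : {for enorm (e0 - y), continuous (fun t : R => t `^ (alpha - 2))}.
      exact/differentiable_continuous/derivable1_diffP.
    exact: (@cvg_comp _ _ _ (fun n => enorm (r n *: e0 - y)) _ _ _ _ en_cvg cP).
  rewrite !mxE; under eq_fun do rewrite !mxE; apply: cvgB; last exact: cvg_cst.
  by rewrite !eqxx /=; under eq_fun do rewrite mulr1.
have fgE : \forall y \ae sg, S y -> (EFin \o f n) y @[n --> \oo] --> (EFin \o g) y.
  by apply/aeW => y y1; apply: cvg_EFin; [exact: nearW|exact: fg].
have fGE : \forall y \ae sg, forall n, S y -> (`|(EFin \o f n) y| <= (EFin \o G) y)%E.
  by apply/aeW => y n y1; rewrite /= lee_fin; exact: fG.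
have [intg _ cvgf] := dominated_convergence mS mf mg fgE intG fGE.
have intf n : sg.-integrable S (EFin \o f n).
  apply: le_integrable intG => //.
  by move=> y y1 /=; rewrite lee_fin; apply: le_trans (ler_norm _); exact: fG.
have gE : \int[sg]_(y in S) g y = Phi alpha 1.
  rewrite /radial_force /sphere_field scale1r; apply: eq_Rintegral => y _.
  rewrite /g indicE; have [Ay|Ay] := pselect (A y); first by rewrite mem_set// mulr1.
  by rewrite memNset// (Ae0 _ Ay) subrr /gradK scaler0 mxE mul0r.
have fcvg : \int[sg]_(y in S) f n y @[n --> \oo] --> Phi alpha 1.
  rewrite -gE; apply: (@fine_cvg _ _ _ _ (fun n => \int[sg]_(y in S) (f n y)%:E)%E).
  by rewrite fineK//; exact: integrable_fin_num.
pose c := (alpha - 2 + D) / D.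
pose T (t : R) := t ^+ d * Phi alpha t - c * t ^+ d.+1.
have aD4 : alpha - 4 + D < 0 by move: alphaD4; move: D => u; lra.
have aD2 : 0 < alpha - 2 + D by move: alphaD2; move: D => u; lra.
(* A strict inequality would be lost in the limit. As every [r n] is at least 1/2, the value at 1/4
   is a fixed positive gap below all [T (r n)]. *)
pose kappa := T 4^-1.
have k0 : 0 < kappa.
  have : T 0 < T 4^-1 by apply: radial_force_excess_incr => //; lra.
  by rewrite /kappa {1}/T (radial_force_0 rad) mulr0 expr0n mulr0 subr0.
have fPhi n : kappa <= r n ^+ d * (\int[sg]_(y in S) f n y) - c * r n ^+ d.+1.
  have /andP[rn1 rn2] := r12 n; have rn0 : 0 < r n by lra.
  have : T 4^-1 < T (r n) by apply: radial_force_excess_incr => //; lra.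
  move/ltW/le_trans; apply; rewrite /T lerD2r ler_wpM2l ?exprn_ge0 ?(ltW rn0)//.
  apply: le_Rintegral => //.
  - by apply: sphere_field_integrable_off; rewrite enorm_axis gtr0_norm// lt_eqF.
  - exact: intf.
  move=> y y1; rewrite /f indicE; have [Ay|Ay] := pselect (A y).
    by rewrite mem_set// mulr1.
  rewrite memNset// mulr0 (Ae0 _ Ay) mxE mulr_ge0_le0 ?powR_ge0// !mxE eqxx mulr1.
  by rewrite subr_le0 ltW.
have lcvg : r n ^+ d * (\int[sg]_(y in S) f n y) - c * r n ^+ d.+1 @[n --> \oo]
    --> Phi alpha 1 - c.
  have expcvg k : r n ^+ k @[n --> \oo] --> (1 : R).
    have cX : {for 1 : R, continuous (fun t : R => t ^+ k)} by exact: exprn_continuous.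
    have := @cvg_comp _ _ _ r _ _ _ _ rcvg cX.
    by rewrite expr1n.
  apply: cvgB.
    by rewrite -[X in _ --> X]mul1r; apply: cvgM.
  by rewrite -[X in _ --> X]mulr1; apply: cvgM => //; exact: cvg_cst.
have : kappa <= Phi alpha 1 - c.
  rewrite -(cvg_lim _ lcvg)//; apply: limr_ge; first by apply/cvg_ex; eexists; exact: lcvg.
  by apply: nearW => n; exact: fPhi.
by rewrite -/c; lra.
Qed.

Definition force_ratio (r : R) : R := Phi alpha r / r.

Lemma force_ratio_cvg0 : force_ratio r @[r --> 0^'+] --> (alpha - 2 + D) / D.
Proof.
have [dP vP] := radial_force_derive_0 rad sph alpha.
have : h^-1 *: (Phi alpha (h + 0) - Phi alpha 0) @[h --> (0 : R)^'] --> (alpha - 2 + D) / D.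
  rewrite -vP; apply: cvg_trans dP; apply: near_eq_cvg; apply: nearW => h /=.
  by rewrite scaler1.
rewrite (radial_force_0 rad) => /cvg_dnbhs_at_right.
apply: cvg_trans; apply: near_eq_cvg; apply: nearW => h /=.
by rewrite addr0 subr0 /force_ratio mulrC.
Qed.

(** For [x > 2] the distances to the sphere lie between x/2 and 2x; the power has a negative
    exponent, so the lower bound serves there and the upper one for the coordinate. *)
Lemma radial_force_upper (x : R) : 2 < x -> `|Phi alpha x| <= (x / 2) `^ (alpha - 2) * (2 * x).
Proof.
move=> x2; have b0 : 0 < 2 - alpha by rewrite subr_gt0.
have x0 : 0 < x by lra.
have int1 : sphere_field_integrable alpha sg (x *: e0).
  by apply: sphere_field_integrable_off; rewrite enorm_axis gtr0_norm// gt_eqF//; lra.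
apply: (le_trans (le_normr_Rintegral mS (int1 ord0))).
set K := _ * (2 * x).
have K0 : 0 <= K by rewrite mulr_ge0 ?powR_ge0//; lra.
apply: (@le_trans _ _ (\int[sg]_(y in S) K)); last first.
  by rewrite Rintegral_cst// [X in fine X]sph/= mulr1.
apply: le_Rintegral => //.
- exact: (integrable_norm (int1 ord0)).
- exact: (@bounded_integrable _ _ R sg S mS _ `|K|).
move=> y y1.
have h1 := enorm_sub_le (x *: e0) y.
have h2 := enorm_sub_ge y (x *: e0).
rewrite -[enorm (y - _)]enormN opprB in h2.
rewrite y1 enorm_axis gtr0_norm// in h1 h2.
set E := enorm (x *: e0 - y) in h1 h2.
have E0 : 0 < E by lra.
rewrite mxE normrM ger0_norm ?powR_ge0// -/E /K ler_pM ?powR_ge0//; last first.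
  by apply: (le_trans (coord_le_enorm _ _)); rewrite -/E; lra.
rewrite -opprB (powRN E) (powRN (x / 2)) lef_pV2 ?posrE ?powR_gt0//; last by lra.
apply: ge0_ler_powR; rewrite ?nnegrE.
- exact: ltW b0.
- lra.
- lra.
- lra.
Qed.

(** Phi(x)/x is O(x^(alpha-2)) at infinity. The variable is inverted because the entries below the
    diagonal are taken at inverses of powers of a small parameter. *)
Lemma force_ratio_inv_cvg0 : force_ratio r^-1 @[r --> 0^'+] --> (0 : R).
Proof.
have b0 : 0 < 2 - alpha by rewrite subr_gt0.
pose K : R := 4 * 2 `^ (2 - alpha).
have bound : \forall r \near (0 : R)^'+, 0 <= `|force_ratio r^-1| <= K * r `^ (2 - alpha).
  near=> r.
  have r0 : 0 < r by near: r; exact: nbhs_right_gt.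
  have r1 : r < 2^-1 by near: r; apply: nbhs_right_lt; rewrite invr_gt0.
  rewrite normr_ge0/= /force_ratio invrK normrM (gtr0_norm r0).
  have x2 : 2 < r^-1 by rewrite -[ltLHS]invrK ltf_pV2 ?posrE ?invr_gt0.
  apply: (@le_trans _ _ ((r^-1 / 2) `^ (alpha - 2) * (2 * r^-1) * r)).
    by rewrite ler_wpM2r ?(ltW r0)// radial_force_upper.
  rewrite -!mulrA mulVf ?gt_eqF// mulr1.
  have -> : (r^-1 / 2) `^ (alpha - 2) = (r * 2) `^ (2 - alpha).
    rewrite -invfM -powR_inv1 ?mulr_ge0 ?(ltW r0)// -powRrM; congr (_ `^ _); ring.
  rewrite powRM ?(ltW r0)// /K.
  have := powR_ge0 r (2 - alpha); have := powR_ge0 2 (2 - alpha).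
  move: (r `^ _) (2 `^ _) => u v v0 u0; nra.
apply: norm_cvg0; apply: (squeeze_cvgr bound); first exact: cvg_cst.
rewrite -[X in _ --> X](mulr0 K); apply: cvgMl_tmp; exact: powR_cvg0.
Unshelve. all: by end_near. Qed.

End limits.

(** * Nearly triangular linear systems *)

Section matrix_limits.
Variables (R : realType) (T : Type) (F : set_system T).
Context {FF : ProperFilter F}.

Lemma cvg_bigsum (I : Type) (s : seq I) (f : I -> T -> R) (l : I -> R) :
  (forall i, f i t @[t --> F] --> l i) ->
  \sum_(i <- s) f i t @[t --> F] --> \sum_(i <- s) l i.
Proof.
move=> fl; elim: s => [|i s IH].
  by rewrite big_nil; under eq_fun do rewrite big_nil; exact: cvg_cst.
by rewrite big_cons; under eq_fun do rewrite big_cons; exact: cvgD.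
Qed.

Lemma cvg_bigprod (I : Type) (s : seq I) (f : I -> T -> R) (l : I -> R) :
  (forall i, f i t @[t --> F] --> l i) ->
  \prod_(i <- s) f i t @[t --> F] --> \prod_(i <- s) l i.
Proof.
move=> fl; elim: s => [|i s IH].
  by rewrite big_nil; under eq_fun do rewrite big_nil; exact: cvg_cst.
by rewrite big_cons; under eq_fun do rewrite big_cons; exact: cvgM.
Qed.

Lemma cvg_det n (A : T -> 'M[R]_n) (B : 'M[R]_n) :
  (forall i j, A t i j @[t --> F] --> B i j) -> \det (A t) @[t --> F] --> \det B.
Proof.
move=> AB; apply: cvg_bigsum => s; apply: cvgM; first exact: cvg_cst.
by apply: cvg_bigprod => i; exact: AB.
Qed.

Lemma cvg_adj n (A : T -> 'M[R]_n) (B : 'M[R]_n) i j :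
  (forall i j, A t i j @[t --> F] --> B i j) ->
  (\adj (A t)) i j @[t --> F] --> (\adj B) i j.
Proof.
move=> AB; rewrite mxE; under eq_fun do rewrite mxE; apply: cvgM; first exact: cvg_cst.
apply: cvg_det => k l; rewrite !mxE; under eq_fun do rewrite !mxE; exact: AB.
Qed.

(** The limit system has an explicit positive solution, and Cramer's formula, adjugate over
    determinant, is continuous in the entries. *)
Lemma near_positive_solution n (g c : R) (A : T -> 'M[R]_n) : 0 < g -> c < g ->
  (forall i j : 'I_n, A t i j @[t --> F] -->
     (if (i == j)%N then g else if (i < j)%N then c else 0)) ->
  \forall t \near F, exists a : 'I_n -> R,
    (forall k, 0 < a k) /\ (forall j, \sum_k A t j k * a k = 1).
Proof.
move=> g0 cg Acvg.
pose B : 'M[R]_n :=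
  \matrix_(i, j) (if (i == j)%N then g else if (i < j)%N then c else 0).
have {}Acvg i j : A t i j @[t --> F] --> B i j by rewrite mxE; exact: Acvg.
have detB : \det B = g ^+ n.
  rewrite -det_tr det_trig; last first.
    apply/is_trig_mxP => i j ij; rewrite !mxE.
    by case: eqVneq => [E|_]; [rewrite E ltnn in ij|rewrite ltnNge (ltnW ij)].
  rewrite -[n in RHS]card_ord -prodr_const; apply: eq_bigr => i _.
  by rewrite !mxE eqxx.
have detB0 : \det B != 0 by rewrite detB expf_neq0// gt_eqF.
(* Subtracting consecutive rows of the limit system gives b_k = (1 - c/g) b_(k+1), and the last row
   gives 1/g; [c < g] makes the ratio positive. *)
pose q := 1 - c / g.
have q0 : 0 < q by rewrite subr_gt0 ltr_pdivrMr// mul1r.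
pose b : 'cV[R]_n := \col_k (q ^+ (n - k.+1) / g).
have Bb : B *m b = const_mx 1.
  apply/matrixP => j l; rewrite ord1 [RHS]mxE mxE.
  rewrite (bigD1 j)//= !mxE eqxx mulrCA divff ?gt_eqF// mulr1.
  have -> : \sum_(k < n | k != j) B j k * b k 0 =
      \sum_(k < n | (j < k)%N) (1 - q) * q ^+ (n - k.+1).
    rewrite big_mkcond [RHS]big_mkcond; apply: eq_bigr => k _; rewrite !mxE.
    have [->|kj] := eqVneq k j; first by rewrite ltnn.
    case: ifP => _; last by rewrite mul0r.
    by rewrite /q; field; rewrite gt_eqF.
  rewrite -mulr_sumr.
  have -> : \sum_(k < n | (j < k)%N) q ^+ (n - k.+1) = \sum_(i < n - j.+1) q ^+ i.
    rewrite -(big_mkord (fun k => (j < k)%N) (fun k => q ^+ (n - k.+1))).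
    rewrite (big_cat_nat (n := j.+1))//= big_nat_cond big1 ?add0r; last first.
      by move=> i /andP[/andP[_ ij] ji]; move: ij; rewrite ltnS leqNgt ji.
    rewrite big_nat_cond [LHS](eq_bigl (fun i => j.+1 <= i < n)%N); last first.
      by move=> i; case: (ltnP j i); rewrite /= ?andbT ?andbF.
    rewrite -big_nat big_nat_rev/= -{1}[j.+1]add0n big_addn big_mkord.
    apply: eq_bigr => i _; congr (_ ^+ _); have := ltn_ord i; have := ltn_ord j; lia.
  have := subrX1 q (n - j.+1); move: (\sum_(i < _) _) => s.
  rewrite -opprB => /eqP; rewrite eqr_oppLR => /eqP E.
  by rewrite -[1 - q]opprB mulNr -E; ring.
have adjb : (\adj B *m const_mx 1 : 'cV[R]_n) = \det B *: b.
  by rewrite -Bb mulmxA mul_adj_mx mul_scalar_mx.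
pose a t (k : 'I_n) := (\det (A t))^-1 * \sum_j (\adj (A t)) k j.
have acvg k : a t k @[t --> F] --> b k 0.
  have -> : b k 0 = (\det B)^-1 * \sum_j (\adj B) k j.
    have /matrixP/(_ k 0) := adjb; rewrite !mxE.
    under eq_bigr do rewrite [const_mx _ _ _]mxE mulr1.
    by move=> ->; rewrite mulrA mulVf// mul1r.
  apply: cvgM; first by apply: cvgV => //; exact: cvg_det.
  by apply: cvg_bigsum => j; exact: cvg_adj.
have det_near : \forall t \near F, \det (A t) != 0.
  have : 0 < `|\det B| by rewrite normr_gt0.
  have /cvg_norm dn := cvg_det Acvg.
  move=> /(cvgr_gt _ dn); apply: filterS => t; exact: normr_gt0 || by rewrite normr_gt0.
have a_near : \forall t \near F, forall k, 0 < a t k.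
  apply: filter_forall => k; apply: (cvgr_gt _ (acvg k)).
  by rewrite mxE divr_gt0// exprn_gt0.
near=> t; exists (a t); split; first by near: t.
move=> j.
have dt : \det (A t) != 0 by near: t.
have /matrixP/(_ j 0) : A t *m (\adj (A t) *m (const_mx 1 : 'cV[R]_n)) = (\det (A t)) *: const_mx 1.
  by rewrite mulmxA mul_mx_adj mul_scalar_mx.
rewrite !mxE mulr1 => E.
rewrite -[RHS](divff dt) -[X in _ = X / _]E mulr_suml; apply: eq_bigr => k _.
rewrite /a -mulrA; congr (_ * _); rewrite mulrC; congr (_ * _).
by rewrite [RHS]mxE; apply: eq_bigr => i _; rewrite [const_mx _ _ _]mxE mulr1.
Unshelve. all: by end_near. Qed.

End matrix_limits.

Lemma cvg_exprn_at_right0 (R : realType) (k : nat) : (0 < k)%N ->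
  x ^+ k @[x --> (0 : R)^'+] --> (0 : R)^'+.
Proof.
move=> k0 A [e /= e0 eA].
change (\forall x \near (0 : R)^'+, A (x ^+ k)).
near=> x; have x0 : 0 < x by near: x; exact: nbhs_right_gt.
have xe : x < e by near: x; exact: nbhs_right_lt.
have x1 : x < 1 by near: x; exact: nbhs_right_lt.
apply: eA; last by rewrite /= exprn_gt0.
rewrite /= sub0r normrN ger0_norm ?exprn_ge0 ?(ltW x0)//.
by apply: le_lt_trans xe; rewrite -[leRHS]expr1 ler_wiXn2l ?(ltW x0) ?(ltW x1).
Unshelve. all: by end_near. Qed.

Section ring_radii.
Variables (R : realType) (d : nat) (sg : probability (borel_rV R d.+1) R).
Hypothesis rad : radially_symmetric sg.
Hypothesis sph : sg (@usphere R d.+1) = 1%E.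
Variable C : R.
Hypothesis C0 : 0 <= C.
Hypothesis capC : forall eps, 0 <= eps -> (sg (polar_cap eps) <= (C * eps ^+ d)%:E)%E.
Variable alpha : R.
Hypotheses (alpha2 : alpha < 2) (alphaD2 : 2 - d.+1%:R < alpha)
  (alphaD4 : alpha < 4 - d.+1%:R).

Lemma ring_radii_exist (n : nat) : exists (a rho : 'I_n -> R),
  [/\ forall k, 0 < rho k,
      forall j k : 'I_n, (j < k)%N -> rho j < rho k,
      forall k, 0 < a k &
      forall j, \sum_k force_ratio sg alpha (rho j / rho k) * a k = 1].
Proof.
pose c := (alpha - 2 + d.+1%:R) / d.+1%:R.
pose g := force_ratio sg alpha 1.
have gE : g = radial_force sg alpha 1 by rewrite /g /force_ratio divr1.
have c0 : 0 < c by rewrite divr_gt0 ?ltr0n//; move: alphaD2; move: (_%:R) => u; lra.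
have cg : c < g by rewrite gE; exact: (radial_force_1_gt rad sph C0 capC).
have g0 : 0 < g := lt_trans c0 cg.
(* With radii t^(n-k) the ratio of radii j and k is t^(k-j). Below the diagonal this is an inverse
   power, as [k - j] would be truncated to 0. *)
pose A (t : R) : 'M[R]_n := \matrix_(j, k)
  (if (j == k)%N then g else if (j < k)%N then force_ratio sg alpha (t ^+ (k - j))
   else force_ratio sg alpha (t ^+ (j - k))^-1).
have Acvg (i j : 'I_n) : A t i j @[t --> (0 : R)^'+] -->
   (if (i == j)%N then g else if (i < j)%N then c else 0).
  under eq_fun do rewrite mxE.
  case: eqVneq => [_|ij]; first exact: cvg_cst.
  case: ifPn => [lij|].
    apply: (@cvg_comp _ _ _ (fun t : R => t ^+ (j - i)) (force_ratio sg alpha) _ ((0 : R)^'+)).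
      by apply: cvg_exprn_at_right0; rewrite subn_gt0.
    exact: force_ratio_cvg0.
  rewrite -leqNgt leq_eqVlt => /orP[/eqP/val_inj ji|ji]; first by rewrite ji eqxx in ij.
  apply: (@cvg_comp _ _ _ (fun t : R => t ^+ (i - j))
    (fun r => force_ratio sg alpha r^-1) _ ((0 : R)^'+)).
    by apply: cvg_exprn_at_right0; rewrite subn_gt0.
  exact: force_ratio_inv_cvg0.
have sol := near_positive_solution g0 cg Acvg.
have [t [[a [a0 aE]] /andP[t0 t1]]] : exists t : R, (exists a : 'I_n -> R,
    (forall k, 0 < a k) /\ (forall j, \sum_k A t j k * a k = 1)) /\ 0 < t < 1.
  apply: (@filter_ex _ ((0 : R)^'+)); near=> t; split; first by near: t; exact: sol.
  apply/andP; split; near: t; [exact: nbhs_right_gt|exact: nbhs_right_lt].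
exists a, (fun k => t ^+ (n - k)); split => //.
- by move=> k; rewrite exprn_gt0.
- move=> j k jk; rewrite ltr_iXn2l//.
  by rewrite ltn_sub2l// (leq_ltn_trans (ltnW jk))// ltn_ord.
move=> j; rewrite -[RHS](aE j); apply: eq_bigr => k _; congr (_ * _).
have tn0 i : t ^+ i != 0 by rewrite expf_neq0// gt_eqF.
rewrite mxE; case: eqVneq => [->|jk]; first by rewrite divff.
case: ifPn => [ljk|].
  congr (force_ratio _ _ _); apply: (mulIf (tn0 (n - k)%N)); rewrite divfK// -exprD.
  by congr (_ ^+ _); clear -ljk; have := ltn_ord k; have := ltn_ord j; lia.
rewrite -leqNgt => kj.
congr (force_ratio _ _ _); apply: (mulIf (tn0 (n - k)%N)); rewrite divfK//.
apply: (mulfI (tn0 (j - k)%N)); rewrite mulrA divff// mul1r -exprD.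
by congr (_ ^+ _); clear -kj; have := ltn_ord k; have := ltn_ord j; lia.
Unshelve. all: by end_near. Qed.

End ring_radii.

(** * Mixtures of uniform rings *)

Definition dilation {R : realType} {d : nat} (s : R) : borel_rV R d -> borel_rV R d :=
  fun x : 'rV[R]_d => s *: x.

Lemma measurable_dilation (R : realType) (d : nat) (s : R) :
  measurable_fun setT (@dilation R d s).
Proof.
apply: measurable_rV => i.
apply: (eq_measurable_fun (fun x : borel_rV R d => s * (x : 'rV[R]_d) 0 i)) => [x _|].
  by rewrite /dilation mxE.
by apply: measurable_funM => //; exact: measurable_coord.
Qed.

Section mixture.
Variables (R : realType) (d n : nat) (sg : probability (borel_rV R d) R).
Variables (m rho : 'I_n -> R).
Hypothesis m0 : forall k, 0 < m k.
Hypothesis m1 : \sum_k m k = 1.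

Lemma mixture_exists : exists mu : probability (borel_rV R d) R,
  (forall A, mu A = \sum_k (m k)%:E * sg (dilation (rho k) @^-1` A))%E /\
  (forall f : borel_rV R d -> \bar R, measurable_fun setT f -> (forall y, 0 <= f y)%E ->
    \int[mu]_y f y = \sum_k (m k)%:E * \int[sg]_y f (dilation (rho k) y))%E.
Proof.
(* [msum] takes a sequence indexed by all naturals; the family is continued by the zero measure. *)
pose M (i : nat) : {measure set (borel_rV R d) -> \bar R} :=
  if insub i is Some k
  then mscale (NngNum (ltW (m0 k))) (push_measure sg (@measurable_dilation R d (rho k)))
  else mzero.
pose nu0 : {measure set (borel_rV R d) -> \bar R} := msum M n.
have nuE A : nu0 A = (\sum_k (m k)%:E * sg (dilation (rho k) @^-1` A))%E.
  by rewrite /nu0/= /msum; apply: eq_bigr => k _; rewrite /M valK.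
have nu1 : nu0 setT = 1%E.
  rewrite nuE; under eq_bigr do rewrite preimage_setT probability_setT mule1.
  by rewrite sumEFin m1.
pose H := Measure_isProbability.Build _ _ _ _ nu1.
pose nu := HB.pack_for (probability (borel_rV R d) R) (Measure.sort nu0) H.
exists nu; split; first exact: nuE.
move=> f mf f0.
have -> : (\int[nu]_y f y = \int[msum M n]_y f y)%E by [].
rewrite ge0_integral_measure_sum//; apply: eq_bigr => k _; rewrite /M valK.
rewrite ge0_integral_mscale//; congr (_ * _)%E.
by rewrite ge0_integral_pushforward//; exact: measurable_dilation.
Qed.

End mixture.

(** Positive and negative parts are treated separately; their integrals are finite, so the
    difference can be taken term by term. *)
Lemma mixture_integral (disp : measure_display) (T : measurableType disp) (R : realType)
    (mu sg : probability T R) (n : nat) (m : 'I_n -> R) (phi : 'I_n -> T -> T) :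
  (forall k, 0 < m k) -> (forall k, measurable_fun setT (phi k)) ->
  (forall f : T -> \bar R, measurable_fun setT f -> (forall y, 0 <= f y)%E ->
    \int[mu]_y f y = \sum_k (m k)%:E * \int[sg]_y f (phi k y))%E ->
  forall f : T -> R, measurable_fun setT f ->
  (forall k, sg.-integrable setT (EFin \o (fun y => f (phi k y)))) ->
  mu.-integrable setT (EFin \o f) /\
  \int[mu]_y f y = \sum_k m k * \int[sg]_y f (phi k y).
Proof.
move=> m0 mphi muE f mf intf.
have mfE : measurable_fun setT (EFin \o f) by exact/measurable_EFinP.
split.
  apply/integrableP; split => //.
  rewrite muE//; last exact: measurableT_comp.
  apply: lte_sum_pinfty => k _; apply: lte_mul_pinfty => //; first by rewrite lee_fin ltW.
  by have /integrableP[] := intf k.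
have fin_pos k : ((\int[sg]_y (EFin \o f)^\+ (phi k y))%E \is a fin_num).
  have := integrable_pos_fin_num measurableT (intf k).
  by rewrite -[EFin \o _]/((EFin \o f) \o phi k) funepos_comp.
have fin_neg k : ((\int[sg]_y (EFin \o f)^\- (phi k y))%E \is a fin_num).
  have := integrable_neg_fin_num measurableT (intf k).
  by rewrite -[EFin \o _]/((EFin \o f) \o phi k) funeneg_comp.
rewrite /Rintegral integralE !muE//; last 2 first.
- exact: measurable_funeneg.
- exact: measurable_funepos.
transitivity (fine (\sum_k (m k * (fine (\int[sg]_y (EFin \o f)^\+ (phi k y))
    - fine (\int[sg]_y (EFin \o f)^\- (phi k y))))%:E)%E).
  congr fine; under eq_bigr do rewrite -(fineK (fin_pos _)) -EFinM.
  under [X in (_ - X)%E]eq_bigr do rewrite -(fineK (fin_neg _)) -EFinM.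
  rewrite !sumEFin -EFinB; congr EFin; rewrite -sumrB.
  by apply: eq_bigr => k _; rewrite mulrBr.
rewrite sumEFin/=; apply: eq_bigr => k _; congr (_ * _).
have -> : (\int[sg]_y (f (phi k y))%:E = \int[sg]_y ((EFin \o f) \o phi k) y)%E by [].
rewrite [in RHS]integralE (funepos_comp (EFin \o f) (phi k)).
rewrite (funeneg_comp (EFin \o f) (phi k)); apply/esym.
exact: (fineB (fin_pos k) (fin_neg k)).
Qed.

Section sphere_to_space.
Variables (R : realType) (d : nat) (sg : probability (borel_rV R d) R).
Hypothesis sph : sg (@usphere R d) = 1%E.

Lemma usphereC_null : sg (~` @usphere R d) = 0%E.
Proof.
rewrite probability_setC; last exact: measurable_usphere.
by rewrite [X in (_ - X)%E]sph subee.
Qed.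

(** Links [velocity], an integral over the whole space, with [sphere_field]. *)
Lemma usphere_integral (f : borel_rV R d -> R) : measurable_fun setT f ->
  sg.-integrable usphere (EFin \o f) ->
  sg.-integrable setT (EFin \o f) /\ \int[sg]_y f y = \int[sg]_(y in usphere) f y.
Proof.
move=> mf intf; have mS := @measurable_usphere R d.
have mfE : measurable_fun setT (EFin \o f) by exact/measurable_EFinP.
have intT : sg.-integrable setT (EFin \o f).
  apply/(negligible_integrable (measurableC mS) measurableT mfE usphereC_null).
  by rewrite setTD setCK.
split=> //; rewrite /Rintegral.
rewrite (negligible_integral (measurableC mS) measurableT intT usphereC_null).
by rewrite setTD setCK.
Qed.

Lemma usphere_measure0 (A : set (borel_rV R d)) : measurable A ->
  (forall x, usphere x -> ~ A x) -> sg A = 0%E.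
Proof.
move=> mA SA; apply/eqP; rewrite eq_le measure_ge0 andbT -usphereC_null.
apply: le_measure; rewrite ?inE//; first by apply: measurableC; exact: measurable_usphere.
by move=> x Ax Sx; exact: (SA x).
Qed.

Lemma usphere_measure1 (A : set (borel_rV R d)) : measurable A ->
  (forall x, usphere x -> A x) -> sg A = 1%E.
Proof.
move=> mA SA; apply/eqP; rewrite eq_le probability_le1// -[X in (X <= _)%E]sph.
apply: le_measure; rewrite ?inE//; exact: measurable_usphere.
Qed.

End sphere_to_space.

(** * Homogeneity, time derivatives and the field of a ring *)

Lemma gradK_scale (R : realType) (d : nat) (alpha s : R) (z : 'rV[R]_d) : 0 < s ->
  gradK alpha (s *: z) = s `^ (alpha - 1) *: gradK alpha z.
Proof.
move=> s0; rewrite /gradK enormZ gtr0_norm// powRM ?enorm_ge0 ?(ltW s0)// !scalerA.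
congr (_ *: _).
rewrite (_ : alpha - 1 = alpha - 2 + 1); last by ring.
rewrite [in RHS]powRD; last by rewrite (gt_eqF s0) implybT.
by rewrite powRr1 ?(ltW s0)//; ring.
Qed.

Section derivatives.
Variables (R : realType).

Lemma has_deriv_within_of_is_derive (D : set R) (f : R -> R) (t l : R) :
  is_derive t 1 f l -> has_deriv_within D (f : R -> R^o) t l.
Proof.
move=> [df vf]; rewrite /has_deriv_within.
have H : h^-1 *: (f (h + t) - f t) @[h --> (0 : R)^'] --> l.
  rewrite -vf; apply: cvg_trans df; apply: near_eq_cvg; apply: nearW => h /=.
  by rewrite scaler1.
apply: cvg_within_filter.
have S : s - t @[s --> t^'] --> (0 : R)^'.
  move=> A [e /= e0 eA]; exists e => //= s st s_t.
  apply: eA; last by rewrite subr_eq0.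
  by rewrite /= sub0r opprB.
have := @cvg_comp _ _ _ _ _ _ _ _ S H.
apply: cvg_trans; apply: near_eq_cvg; apply: nearW => s /=.
by rewrite subrK.
Qed.

Lemma has_deriv_within_scale (V : normedModType R) (D : set R) (f : R -> R) (t l : R) (x : V) :
  has_deriv_within D (f : R -> R^o) t l ->
  has_deriv_within D (fun s => f s *: x) t (l *: x).
Proof.
rewrite /has_deriv_within => H.
have {}H : (s - t)^-1 * (f s - f t) @[s --> within D t^'] --> l by exact: H.
have FF : Filter (within D t^') by apply: within_filter.
under eq_fun do rewrite -scalerBl scalerA.
exact: (cvgZr_tmp (a := x) H).
Qed.

End derivatives.

Lemma image_measure_integral (d1 d2 : measure_display) (T1 : measurableType d1)
    (T2 : measurableType d2) (R : realType) (mu : probability T1 R) (nu : probability T2 R)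
    (phi : T1 -> T2) (f : T2 -> R) :
  measurable_fun setT phi -> measurable_fun setT f ->
  (forall A, measurable A -> nu A = mu (phi @^-1` A)) ->
  mu.-integrable setT (EFin \o (fun x => f (phi x))) ->
  nu.-integrable setT (EFin \o f) /\ \int[nu]_y f y = \int[mu]_x f (phi x).
Proof.
move=> mphi mf nuE intf.
have mfE : measurable_fun setT (EFin \o f) by exact/measurable_EFinP.
have key (g : T2 -> \bar R) :
    (\int[nu]_y g y = \int[push_measure mu mphi]_y g y)%E.
  by apply: eq_measure_integral => A mA _; exact: nuE.
have intp := @integrable_pushforward _ _ _ _ _ _ mphi mu setT (EFin \o f) mfE intf measurableT.
split.
  by apply/integrableP; split=> //; rewrite key; have /integrableP[_] := intp.
by rewrite /Rintegral key (integral_pushforward mphi mfE intf measurableT).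
Qed.

Section rings.
Variables (R : realType) (d n : nat) (sg : probability (borel_rV R d.+1) R).
Hypothesis rad : radially_symmetric sg.
Hypothesis sph : sg (@usphere R d.+1) = 1%E.

Lemma enorm_continuous : continuous (@enorm R d.+1).
Proof.
move=> x; apply: (@continuous_comp _ _ _ (fun x : 'rV[R]_d.+1 => \sum_i x 0 i ^+ 2) Num.sqrt);
  last exact: sqrt_continuous.
apply: (cvg_bigsum (FF := nbhs_pfilter x)) => i.
apply: (@cvg_comp _ _ _ (fun x : 'rV[R]_d.+1 => x 0 i) (fun t : R => t ^+ 2)).
  exact: coord_continuous.
exact: exprn_continuous.
Qed.

(** The complement of the rings is a null set, and it is open as the set where a continuous product
    does not vanish. *)
Lemma ring_support (mu : probability (borel_rV R d.+1) R) (m c : 'I_n -> R) x :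
  (forall k, 0 < c k) ->
  (forall A, measurable A -> mu A = \sum_k (m k)%:E * sg (dilation (c k) @^-1` A))%E ->
  msupport mu x -> exists k, enorm x = c k.
Proof.
move=> c0 muE supp; apply: contrapT => /forallNP xc.
pose p (z : 'rV[R]_d.+1) := \prod_k (enorm z - c k).
pose U := p @^-1` [set t | t != 0].
have oU : open U.
  apply: open_comp; last exact: open_neq.
  move=> z _; apply: (cvg_bigprod (FF := nbhs_pfilter z)) => k; apply: cvgB; last exact: cvg_cst.
  exact: enorm_continuous.
have Ux : U x.
  by apply/prodf_neq0 => k _; rewrite subr_eq0; apply/eqP; exact: xc.
have mU : measurable (U : set (borel_rV R d.+1)) by exact: sub_sigma_algebra.
have := supp U oU Ux; rewrite muE// big1 ?ltxx// => k _.
rewrite (usphere_measure0 sph) ?mule0//.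
  by apply: (preimage_measurable (@measurable_dilation R d.+1 (c k))).
move=> y y1; rewrite /U /p/dilation/= => /negP; apply; apply/prodf_eq0.
by exists k => //; rewrite enormZ y1 mulr1 gtr0_norm// subrr.
Qed.

Variable C : R.
Hypothesis C0 : 0 <= C.
Hypothesis capC : forall eps, 0 <= eps -> (sg (polar_cap eps) <= (C * eps ^+ d)%:E)%E.
Variable alpha : R.
Hypothesis alphaD2 : 2 - d.+1%:R < alpha.

(** By homogeneity a ring of radius [s] acts at [x] as s^(alpha-1) times the unit ring at x/s;
    writing Phi as the ratio times |x|/s leaves s^(alpha-2). *)
Lemma ring_field (s : R) (x : 'rV[R]_d.+1) (i : 'I_d.+1) : 0 < s -> x != 0 ->
  sg.-integrable setT (EFin \o (fun y : borel_rV R d.+1 =>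
    gradK alpha (x - (dilation s y : 'rV[R]_d.+1)) 0 i)) /\
  \int[sg]_y gradK alpha (x - (dilation s y : 'rV[R]_d.+1)) 0 i =
    s `^ (alpha - 2) * force_ratio sg alpha (enorm x / s) * x 0 i.
Proof.
move=> s0 x0.
have E (y : 'rV[R]_d.+1) : gradK alpha (x - (dilation s y : 'rV[R]_d.+1)) 0 i =
    s `^ (alpha - 1) * gradK alpha (s^-1 *: x - y) 0 i.
  have -> : x - (dilation s y : 'rV[R]_d.+1) = s *: (s^-1 *: x - y).
    by rewrite scalerBr scalerA divff ?scale1r// gt_eqF.
  by rewrite gradK_scale// mxE.
have sx0 : s^-1 *: x != 0 by rewrite scaler_eq0 invr_eq0 gt_eqF.
have sx : enorm (s^-1 *: x) = enorm x / s.
  by rewrite enormZ gtr0_norm ?invr_gt0// mulrC.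
have [intx fx] := sphere_field_radial rad sx0
  (sphere_field_integrable_axis C0 capC alphaD2 (enorm_ge0 (s^-1 *: x))).
have mg := @measurable_gradK R d.+1 alpha (s^-1 *: x) i.
have [intT ET] := usphere_integral sph mg (intx i).
have xp : 0 < enorm x by rewrite lt_neqAle eq_sym enorm_eq0 x0 enorm_ge0.
split.
  apply: eq_integrable (integrableZl measurableT (s `^ (alpha - 1)) intT) => //.
  by move=> y _ /=; rewrite E EFinM.
under eq_Rintegral do rewrite E.
rewrite RintegralZl// ET -/(sphere_field _ _ _ _) fx sx /force_ratio /radial_force !mxE.
rewrite (_ : alpha - 1 = alpha - 2 + 1); last by ring.
rewrite powRD; last by rewrite (gt_eqF s0) implybT.
rewrite powRr1 ?(ltW s0)//; field.
by rewrite !gt_eqF.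
Qed.

End rings.

Lemma mixture_radially_symmetric (R : realType) (d n : nat)
    (sg mu : probability (borel_rV R d) R) (m rho : 'I_n -> R) :
  radially_symmetric sg ->
  (forall A, mu A = \sum_k (m k)%:E * sg (dilation (rho k) @^-1` A))%E ->
  radially_symmetric mu.
Proof.
move=> rad muE Q QQ A mA; rewrite !muE; apply: eq_bigr => k _; congr (_ * _)%E.
have mkA : measurable (dilation (rho k) @^-1` A).
  exact: (preimage_measurable (@measurable_dilation R d (rho k))).
rewrite -[RHS](rad Q QQ _ mkA); congr (sg _).
by apply/seteqP; split => y /=; rewrite /dilation scalemxAl.
Qed.

Lemma mixture_radial_part (R : realType) (d n : nat)
    (sg mu : probability (borel_rV R d) R) (m rho : 'I_n -> R) (I : set R) :
  sg (@usphere R d) = 1%E -> (forall k, 0 < rho k) ->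
  (forall A, mu A = \sum_k (m k)%:E * sg (dilation (rho k) @^-1` A))%E ->
  measurable I -> radial_part mu I = (\sum_(k < n) (m k)%:E * \d_(rho k) I)%E.
Proof.
move=> sph rho0 muE mI; rewrite /radial_part /pushforward muE.
apply: eq_bigr => k _; congr (_ * _)%E.
set A := _ @^-1` _.
have mA : measurable A.
  apply: (preimage_measurable (@measurable_dilation R d (rho k))).
  exact: (preimage_measurable (@measurable_enorm R d)).
have AE (y : borel_rV R d) : usphere y -> A y = I (rho k).
  by move=> y1; rewrite /A/=/dilation enormZ y1 mulr1 gtr0_norm.
rewrite diracE; have [Ik|Ik] := pselect (I (rho k)).
  by rewrite mem_set// (usphere_measure1 sph)// => y /AE ->.
by rewrite memNset// (usphere_measure0 sph)// => y /AE ->.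
Qed.

(** Explicit solution of r' = -lambda r^(alpha-1) with r(0) = 1: by separation of variables
    r^(2-alpha) is affine in time, with slope -(2 - alpha) lambda. *)
Lemma similarity_rate_derive (R : realType) (alpha lambda t : R) :
  alpha < 2 -> 0 < lambda -> 0 <= t < ((2 - alpha) * lambda)^-1 ->
  let r s := (1 - s / ((2 - alpha) * lambda)^-1) `^ (2 - alpha)^-1 in
  0 < r t /\ is_derive t 1 r (- (lambda * r t `^ (alpha - 1))).
Proof.
move=> a2 l0 /andP[t0 tT] r.
have b0 : 0 < 2 - alpha by rewrite subr_gt0.
have T0 : 0 < (2 - alpha) * lambda by rewrite mulr_gt0.
pose h (s : R) := 1 - s / ((2 - alpha) * lambda)^-1.
have h0 : 0 < h t.
  by rewrite /h invrK subr_gt0 -ltr_pdivlMr// div1r.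
have dh : is_derive t 1 h (- ((2 - alpha) * lambda)).
  have -> : h = (fun s => 1 - ((2 - alpha) * lambda) * s).
    by apply/funext => s; rewrite /h invrK mulrC.
  by apply: is_derive_eq; rewrite /GRing.scale/=; ring.
split; first by rewrite powR_gt0.
have := is_derive1_comp (is_derive1_powR (2 - alpha)^-1 h0) dh.
move=> /is_derive_eq; apply.
rewrite /r -/(h t) -powRrM.
have -> : (2 - alpha)^-1 * (alpha - 1) = (2 - alpha)^-1 - 1 by field; rewrite gt_eqF.
by field; rewrite gt_eqF.
Qed.

Theorem theorem4p1 (R : realType) (d : nat) (hd : (1 <= d)%N)
    (alpha : R) (halpha2 : alpha < 2)
    (halphad : 2 - d%:R < alpha < 4 - d%:R)
    (n : nat) (hn : (2 <= n)%N) :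
  exists (mu : R -> probability (borel_rV R d) R) (r : R -> R) (T0 : R)
         (m rho : 'I_n -> R),
    [/\ first_kind_similarity_solution alpha mu r T0,
        forall I : set R, measurable I -> I `<=` `[0, +oo[ ->
          radial_part (mu 0) I = (\sum_(k < n) (m k)%:E * \d_(rho k) I)%E,
        forall k : 'I_n, 0 < m k,
        \sum_(k < n) m k = 1
      & (forall k : 'I_n, 0 < rho k) /\
        (forall j k : 'I_n, (j < k)%N -> rho j < rho k)].
Proof.
case: d hd halphad => // d _ /andP[alphaD2 alphaD4].
have [sg [rad sph [C C0 capC]]] := uniform_sphere_exists R d.
have [a [rho [rho0 rho_lt a0 aE]]] :=
  ring_radii_exist rad sph C0 capC halpha2 alphaD2 alphaD4 n.
(* The unknowns are a_k = m_k rho_k^(alpha-2) up to scale. Dividing by [s] gives total mass 1 and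
   turns the right-hand side 1 of the system into lambda = 1/s. *)
pose s := \sum_k a k * rho k `^ (2 - alpha).
have s0 : 0 < s.
  rewrite /s (bigD1 (Ordinal (leq_trans (isT : 0 < 2)%N hn)))//=.
  rewrite ltr_pwDl ?sumr_ge0// => [|k _]; first by rewrite mulr_gt0// powR_gt0.
  by rewrite ltW// mulr_gt0// powR_gt0.
pose m k := a k * rho k `^ (2 - alpha) / s.
have m0 k : 0 < m k by rewrite divr_gt0// mulr_gt0// powR_gt0.
have m1 : \sum_k m k = 1 by rewrite -mulr_suml divff// gt_eqF.
pose lambda := s^-1; have l0 : 0 < lambda by rewrite invr_gt0.
have [mu0 [mu0E mu0_int]] := mixture_exists sg rho m0 m1.
have T0 : 0 < ((2 - alpha) * lambda)^-1 by rewrite invr_gt0 mulr_gt0// subr_gt0.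
pose r t := (1 - t / ((2 - alpha) * lambda)^-1) `^ (2 - alpha)^-1.
have r0 : r 0 = 1 by rewrite /r mul0r subr0 powR1.
have /choice[mu muE] : forall t, exists nu : probability (borel_rV R d.+1) R,
    forall A, nu A = mu0 (dilation (r t) @^-1` A).
  move=> t; pose phi : {mfun borel_rV R d.+1 >-> borel_rV R d.+1} :=
    HB.pack (@dilation R d.+1 (r t))
      (isMeasurableFun.Build _ _ _ _ _ (@measurable_dilation R d.+1 (r t))).
  by exists (distribution mu0 phi).
have mu_0 A : mu 0 A = mu0 A.
  rewrite muE r0; congr (mu0 _); apply/seteqP; split => y /=; by rewrite /dilation scale1r.
(* On the ring of index [j] the field of the mixture is the j-th equation of the linear system,
   multiplied by lambda x. *)
have static x j i : enorm x = rho j ->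
    mu0.-integrable setT (EFin \o (fun y : borel_rV R d.+1 =>
      gradK alpha (x - (y : 'rV[R]_d.+1)) 0 i)) /\
    \int[mu0]_y gradK alpha (x - (y : 'rV[R]_d.+1)) 0 i = lambda * x 0 i.
  move=> xj; have x0 : x != 0 by rewrite -enorm_eq0 xj gt_eqF.
  have rf k := ring_field rad sph C0 capC alphaD2 i (rho0 k) x0.
  have [h1 ->] := mixture_integral m0 (fun k => @measurable_dilation R d.+1 (rho k)) mu0_int
    (@measurable_gradK R d.+1 alpha x i) (fun k => (rf k).1).
  split => //.
  rewrite -[RHS]mulr1 -(aE j) mulr_sumr; apply: eq_bigr => k _.
  have [_ ->] := rf k; rewrite xj /m /lambda.
  have -> : rho k `^ (alpha - 2) = (rho k `^ (2 - alpha))^-1 by rewrite -powRN opprB.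
  by field; rewrite !gt_eqF// powR_gt0.
(* Dilating the measure and the point together multiplies the kernel by (r t)^(alpha-1), the
   right-hand side of the equation for [r]. *)
have moving t x j i : 0 < r t -> enorm x = rho j ->
    (mu t).-integrable setT (EFin \o (fun y : borel_rV R d.+1 =>
      gradK alpha (r t *: x - (y : 'rV[R]_d.+1)) 0 i)) /\
    \int[mu t]_y gradK alpha (r t *: x - (y : 'rV[R]_d.+1)) 0 i =
      lambda * r t `^ (alpha - 1) * x 0 i.
  move=> rt xj; have [h1 h2] := static x j i xj.
  have E (y : 'rV[R]_d.+1) : gradK alpha (r t *: x - dilation (r t) y) 0 i =
      r t `^ (alpha - 1) * gradK alpha (x - y) 0 i.
    by rewrite /dilation -scalerBr gradK_scale// mxE.
  have [|i1 ->] := image_measure_integral (@measurable_dilation R d.+1 (r t))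
    (@measurable_gradK R d.+1 alpha (r t *: x) i) (fun A _ => muE t A).
    apply: eq_integrable (integrableZl measurableT (r t `^ (alpha - 1)) h1) => //.
    by move=> y _ /=; rewrite E EFinM.
  split => //; under eq_Rintegral do rewrite E.
  by rewrite RintegralZl// h2; ring.
have supp0 x : msupport (mu 0) x -> exists j, enorm x = rho j.
  by apply: (ring_support sph rho0) => A _; rewrite mu_0 mu0E.
have suppt t x : 0 < r t -> msupport (mu t) x -> exists j, enorm x = r t * rho j.
  move=> rt; apply: (ring_support sph) => [k|A _]; first by rewrite mulr_gt0.
  rewrite muE mu0E; apply: eq_bigr => k _; congr (_ * sg _)%E.
  by apply/seteqP; split => y /=; rewrite /dilation scalerA.
exists mu, r, ((2 - alpha) * lambda)^-1, m, rho; split => //.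
- split => //.
  + exact: (mixture_radially_symmetric rad (fun A => etrans (mu_0 A) (mu0E A))).
  + split=> // t tT; have [rt dr] := similarity_rate_derive halpha2 l0 tT => //.
    by eexists; exact: (has_deriv_within_of_is_derive _ dr).
  + by move=> t tT A mA; rewrite muE /pushforward mu_0.
  move=> t tT; have [rt dr] := similarity_rate_derive halpha2 l0 tT; split.
    move=> x /(suppt t x rt)[j xj] _ i.
    have xr : enorm ((r t)^-1 *: x) = rho j.
      by rewrite enormZ gtr0_norm ?invr_gt0// xj mulKf// gt_eqF.
    have [h1 _] := moving t _ j i rt xr.
    by move: h1; rewrite scalerA mulfV ?scale1r// gt_eqF.
  move=> x /supp0[j xj].
  have -> : velocity alpha (mu t) (r t *: x) = - (lambda * r t `^ (alpha - 1)) *: x.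
    rewrite /velocity ifF; last first.
      by rewrite scaler_eq0 gt_eqF//= -enorm_eq0 xj gt_eqF.
    apply/rowP => i; rewrite !mxE; have [_ ->] := moving t x j i rt xj.
    by rewrite mulNr.
  have H := has_deriv_within_of_is_derive `[0, ((2 - alpha) * lambda)^-1[ dr.
  exact: (@has_deriv_within_scale R 'rV[R]_d.+1 _ _ _ _ x H).
- move=> I mI _.
  exact: (mixture_radial_part sph rho0 (fun A => etrans (mu_0 A) (mu0E A)) mI).
Qed.
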